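(* Let $X$ be a compact complex manifold, and let $L$ be a holomorphic line bundle over $X$. Let $S$ be the set of globalizable metrics on $L$. Then $S$ is stable. In fact $I(S)$ is at most $\dim H^0(X,L^* )-1$.
   Context: For a complex manifold $M$ with complex conjugate manifold $M'$, a holomorphic function $R:M\times M'\to\mathbb{C}$ (written $R(z,\overline w)$) is Hermitian symmetric if $R(z,\overline w)=\overline{R(w,\overline z)}$ for all $z,w\in M$; $\mathcal{P}_0(M)$ denotes the set of these functions. For each positive integer $N$, $\mathcal{P}_N(M)$ is the set of $R\in\mathcal{P}_0(M)$ such that $\sum_{i,j=1}^N R(z_i,\overline{z_j})a_i\overline{a_j}\ge 0$ for all $(z_1,\dots,z_N)\in M^N$ and all $a\in\mathbb{C}^N$; $\mathcal{P}_\infty(M)=\bigcap_{N=1}^\infty\mathcal{P}_N(M)$. For a subset $S\subset\mathcal{P}_0(M)$, the stability index $I(S)$ is the smallest $k$ for which $S\cap\mathcal{P}_\infty(M)=S\cap\mathcal{P}_k(M)$, and $I(S)=\infty$ if no such $k$ exists; $S$ is called stable if $I(S)$ is finite. Here $M=L$ is the total space of the line bundle, $L^*$ is the dual bundle, and $H^0(X,L^* )$ is the (finite-dimensional) complex vector space of holomorphic sections of $L^*$; such sections are regarded as holomorphic functions on $L$ that are linear on the fibres. Let $\{\phi_\alpha\}$ be a basis of $H^0(X,L^* )$. A globalizable metric on $L$ (short for globalizable singular metric) is a Hermitian symmetric function on $L\times L'$ of the form $R_C(z,\overline w)=\sum_{\alpha,\beta}c_{\alpha\beta}\,\phi_\alpha(z)\overline{\phi_\beta(w)}$,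 where $C$ is a Hermitian form on $H^0(X,L^* )$ and $c_{\alpha\beta}=\langle C\phi_\alpha,\phi_\beta\rangle$.
   Formalization: X is taken connected, the usual convention (two points with dim H^0 = 2 violate the bound); the bound dim H^0(X,L^* ) - 1 is claimed only when dim H^0(X,L^* ) is at least 2, since it fails for dimensions 0 and 1; stability is claimed for every dimension. *)

(* Defs.v *)
(* MathComp / MathComp-Analysis *)
From HB Require Import structures.
From mathcomp Require Import all_boot all_order all_algebra complex.
From mathcomp Require Import all_classical all_reals all_analysis.

Set Implicit Arguments.
Unset Strict Implicit.
Unset Printing Implicit Defensive.

Import Order.TTheory GRing.Theory Num.Theory numFieldNormedType.Exports.

Local Open Scope classical_set_scope.
Local Open Scope ring_scope.

(* The library normalizes R[i]^o but not R[i] itself: copy the structures, so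
   that C, C^n and complex differentiability are available on R[i]. *)
#[export, non_forgetful_inheritance]
HB.instance Definition _ (R : realType) := GRing.ComAlgebra.copy R[i] R[i]^o.
#[export, non_forgetful_inheritance]
HB.instance Definition _ (R : realType) := Vector.copy R[i] R[i]^o.
#[export, non_forgetful_inheritance]
HB.instance Definition _ (R : realType) := NormedModule.copy R[i] R[i]^o.

(* Charts with values in C^n.  Only the restrictions of [cmap] to [cdom] and of
   [cinv] to the image of [cdom] are meaningful.  The carrier is a bare type:
   the total space of a bundle and the conjugate and product manifolds are
   given below by their atlases, which also determine their topologies. *)
Record chart (R : realType) (M : Type) (n : nat) := Chart {
  cdom : set M ;
  cmap : M -> 'rV[R[i]]_n ;
  cinv : 'rV[R[i]]_n -> M }.

(* [differentiable] is Frechet differentiability over the field R[i], i.e.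
   complex differentiability of the coordinate expression of [f]. *)
Definition holomorphic_on (R : realType) (M : Type) (n : nat)
    (A : set (chart R M n)) (U : set M) (f : M -> R[i]) : Prop :=
  forall (c : chart R M n) (x : M), A c -> cdom c x -> U x ->
    differentiable (f \o cinv c) (cmap c x).

Definition complex_chart (R : realType) (X : topologicalType) (n : nat)
    (c : chart R X n) : Prop :=
  [/\ open (cdom c),
      open (cmap c @` cdom c),
      {in cdom c, cancel (cmap c) (cinv c)},
      {within cdom c, continuous (cmap c)} &
      {within cmap c @` cdom c, continuous (cinv c)}].

(* Complex manifolds are connected by convention. *)
Definition complex_manifold (R : realType) (X : topologicalType) (n : nat)
    (A : set (chart R X n)) : Prop :=
  [/\ hausdorff_space X /\ @second_countable X,
      connected [set: X],
      (forall x : X, exists2 c, A c & cdom c x),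
      (forall c, A c -> complex_chart c) &
      (forall c c' (x : X), A c -> A c' -> cdom c x -> cdom c' x ->
         differentiable (cmap c' \o cinv c) (cmap c x))].

Definition conj_chart (R : realType) (M : Type) (n : nat)
    (c : chart R M n) : chart R M n :=
  Chart (cdom c)
    (fun z => map_mx Num.conj (cmap c z))
    (fun y => cinv c (map_mx Num.conj y)).

(* The conjugate manifold M' has the same points as M. *)
Definition conj_atlas (R : realType) (M : Type) (n : nat)
    (A : set (chart R M n)) : set (chart R M n) :=
  [set conj_chart c | c in A].

Definition prod_chart (R : realType) (M1 M2 : Type) (n1 n2 : nat)
    (c1 : chart R M1 n1) (c2 : chart R M2 n2) :
    chart R (M1 * M2)%type (n1 + n2) :=
  Chart (cdom c1 `*` cdom c2)
    (fun p => row_mx (cmap c1 p.1) (cmap c2 p.2))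
    (fun y => (cinv c1 (lsubmx y), cinv c2 (rsubmx y))).

Definition prod_atlas (R : realType) (M1 M2 : Type) (n1 n2 : nat)
    (A1 : set (chart R M1 n1)) (A2 : set (chart R M2 n2)) :
    set (chart R (M1 * M2)%type (n1 + n2)) :=
  [set prod_chart c1 c2 | c1 in A1 & c2 in A2].

(* A line bundle over X is given by its fibres [E x], which are complex vector
   spaces, and by local trivializations whose transition functions are
   holomorphic; its total space is [{x : X & E x}]. *)
Record trivialization (R : realType) (X : Type) (E : X -> lmodType R[i]) :=
  Trivialization {
    tdom : set X ;
    tmap : forall x : X, E x -> R[i] ;
    tinv : forall x : X, R[i] -> E x }.

Definition holomorphic_line_bundle (R : realType) (X : topologicalType)
    (n : nat) (A : set (chart R X n)) (E : X -> lmodType R[i])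
    (T : set (trivialization E)) : Prop :=
  [/\ (forall x : X, exists2 t, T t & tdom t x),
      (forall t, T t -> open (tdom t)),
      (forall t (x : X), T t -> tdom t x ->
         [/\ scalar (tmap t (x := x)),
             cancel (tmap t (x := x)) (tinv t x) &
             cancel (tinv t x) (tmap t (x := x))]) &
      (forall t t', T t -> T t' ->
         holomorphic_on A (tdom t `&` tdom t')
           (fun x => tmap t' (tinv t x 1)))].

Definition total_chart (R : realType) (X : Type) (n : nat)
    (E : X -> lmodType R[i]) (c : chart R X n) (t : trivialization E) :
    chart R {x : X & E x} (n + 1) :=
  Chart [set v : {x : X & E x} | cdom c (tag v) /\ tdom t (tag v)]
    (fun v : {x : X & E x} => row_mx (cmap c (tag v)) (const_mx (tmap t (tagged v))))
    (fun y => Tagged E (tinv t (cinv c (lsubmx y)) (rsubmx y 0 0))).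

Definition total_atlas (R : realType) (X : Type) (n : nat)
    (E : X -> lmodType R[i]) (A : set (chart R X n))
    (T : set (trivialization E)) : set (chart R {x : X & E x} (n + 1)) :=
  [set total_chart c t | c in A & t in T].

(* H^0(X, L^* ), its elements being regarded as holomorphic functions on the
   total space of L that are linear on the fibres. *)
Definition dual_sections (R : realType) (X : Type) (n : nat)
    (E : X -> lmodType R[i]) (A : set (chart R X n))
    (T : set (trivialization E)) : set ({x : X & E x} -> R[i]) :=
  [set f | holomorphic_on (total_atlas A T) setT f /\
           forall x : X, scalar (fun v : E x => f (Tagged E v))].

Definition is_basis (R : realType) (M : Type) (V : set (M -> R[i])) (d : nat)
    (phi : 'I_d -> M -> R[i]) : Prop :=
  [/\ (forall i, V (phi i)),
      (forall a : 'I_d -> R[i],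
         (forall z, \sum_(i < d) a i * phi i z = 0) -> forall i, a i = 0) &
      (forall f, V f -> exists a : 'I_d -> R[i],
         forall z, f z = \sum_(i < d) a i * phi i z)].

(* [C f g] stands for <C f, g>, linear in the first argument; its values
   outside the space of functions [V] are irrelevant. *)
Definition hermitian_form (R : realType) (M : Type) (V : set (M -> R[i]))
    (C : (M -> R[i]) -> (M -> R[i]) -> R[i]) : Prop :=
  (forall (a : R[i]) f g h, V f -> V g -> V h ->
     C (fun z => a * f z + g z) h = a * C f h + C g h) /\
  (forall f g, V f -> V g -> C f g = (C g f)^*).

(* Below, [K z w] stands for the value K(z, \bar w) of a function K on
   M x M'. *)

Definition globalizable_metrics (R : realType) (M : Type)
    (V : set (M -> R[i])) (d : nat) (phi : 'I_d -> M -> R[i]) :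
    set (M -> M -> R[i]) :=
  [set K | exists2 C, hermitian_form V C &
     forall z w, K z w = \sum_(i < d) \sum_(j < d)
       C (phi i) (phi j) * phi i z * (phi j w)^*].

Definition hermitian_symmetric (R : realType) (M : Type) (n : nat)
    (A : set (chart R M n)) : set (M -> M -> R[i]) :=
  [set K | holomorphic_on (prod_atlas A (conj_atlas A)) setT
             (fun p => K p.1 p.2) /\
           forall z w, K z w = (K w z)^*].

(* P_N(M); for N = 0 the sum is empty and this is P_0(M).  In R[i], 0 <= x
   means that x is real and nonnegative. *)
Definition pos_class (R : realType) (M : Type) (n : nat)
    (A : set (chart R M n)) (N : nat) : set (M -> M -> R[i]) :=
  [set K | hermitian_symmetric A K /\
     forall (z : 'I_N -> M) (a : 'I_N -> R[i]),
       0 <= \sum_(i < N) \sum_(j < N) K (z i) (z j) * a i * (a j)^*].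

Definition pos_class_infty (R : realType) (M : Type) (n : nat)
    (A : set (chart R M n)) : set (M -> M -> R[i]) :=
  \bigcap_(N in [set N | (0 < N)%N]) pos_class A N.

(* The infimum of a set of natural numbers in \bar R is its smallest element,
   or +oo if the set is empty. *)
Definition stability_index (R : realType) (M : Type) (n : nat)
    (A : set (chart R M n)) (S : set (M -> M -> R[i])) : \bar R :=
  ereal_inf [set (k%:R)%:E | k in
    [set k : nat | S `&` pos_class_infty A = S `&` pos_class A k]].

Definition stable (R : realType) (M : Type) (n : nat)
    (A : set (chart R M n)) (S : set (M -> M -> R[i])) : Prop :=
  stability_index A S \is a fin_num.

(* Main.v *)
Require Import Defs.
From HB Require Import structures.
From mathcomp Require Import all_boot all_order all_algebra complex.
From mathcomp Require Import ring lra.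
From mathcomp Require Import all_classical all_reals all_analysis.

Set Implicit Arguments.
Unset Strict Implicit.
Unset Printing Implicit Defensive.

Import Order.TTheory GRing.Theory Num.Theory Normc numFieldNormedType.Exports.

Local Open Scope classical_set_scope.
Local Open Scope ring_scope.

(** Sections of L^* are functions on L, and a globalizable metric K with
    Hermitian matrix H satisfies
      sum K(z_i, z_j) a_i conj(a_j) = q (sum a_i ev z_i),
    where q is the Hermitian form of H on row vectors of length d and
    ev z = (phi_1 z, ..., phi_d z).  So K lies in P_N exactly when q is
    nonnegative on sums of N vectors of the image of ev, which is a cone
    ([kernel_sum_qf]).  The functions phi_i are independent, so this image
    contains a basis; hence P_d already gives q >= 0 everywhere
    ([pos_of_dim]), which is stability.

    To gain one, suppose that q >= 0 on sums of d - 1 vectors of the cone but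
    that q is negative somewhere.  A small multiple of the identity added to q
    makes it positive on the span W of d - 2 independent vectors ev z_i and
    keeps a negative value.  The orthogonal complement of W is then a plane
    which contains a negative vector e.  The projection of ev z to this plane is
    ev z minus a vector of W, hence a sum of d - 1 vectors of the cone, on which
    the form is nonnegative.  In coordinates (s, t) of the plane
    along e and its orthogonal this says |s| <= K |t| at all points of L, where
    s and t come from linearly independent functionals
    ([dominated_pair]).  They are two sections of L^* with bounded
    quotient on a compact connected manifold, and [domination] shows that such
    sections are proportional: a contradiction.

    The proof of [domination] normalizes sup |s/t| = 1.  By compactness the
    supremum is approached in every neighbourhood of some point x0.
    The Schwarz-Pick inequality, in the division-free form
      |s(b) - al t(b)| <= 1/2 |t(b) - conj(al) s(b)|,   al = s(a)/t(a),
    holds for all a, b close to x0 ([schwarz_pick]); letting |al| tend to 1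
    gives |s| = |t| near x0, then s = al t near x0, and the identity
    theorem extends the equality to X.  The difficulty is at the common
    zeros of s and t.  For a bounded quotient S/D the functions D^2 (S/D)^k are
    complex derivable also at the zeros of D, and a crude Cauchy estimate
    applied to all of them, followed by k-th roots, is a sharp maximum
    principle for S/D ([quotient_maximum_principle]).

    The Cauchy estimate ([cauchy_estimate]) is proved for functions which are
    merely complex derivable at every point, by Goursat's bisection.
    Contour integrals are replaced by trapezoid sums along squares: they
    are additive under bisection and vanish exactly on affine functions, which
    is all that the bisection argument uses. *)

(** * Modulus of a complex number *)

Section ComplexNorm.
Variable R : realType.
Notation C := R[i].
Notation j := ('i%C : C).

Lemma normc_ge0 (z : C) : 0 <= normc z.
Proof. by case: z => a b /=; apply: sqrtr_ge0. Qed.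

Lemma normcD (x y : C) : normc (x + y) <= normc x + normc y.
Proof. exact: le_normcD. Qed.

Lemma normc_gt0 (z : C) : (0 < normc z) = (z != 0).
Proof.
rewrite lt_def normc_ge0 andbT; congr (~~ _); apply/eqP/eqP => [/eq0_normc//|->].
exact: normc0.
Qed.

Lemma normcB (x y : C) : normc (x - y) <= normc x + normc y.
Proof. by rewrite -[normc y]normcN; exact: normcD. Qed.

Lemma normc_dist (x y : C) : normc (x - y) = normc (y - x).
Proof. by rewrite -normcN opprB. Qed.

Lemma normc_real (x : R) : normc (x%:C)%C = `|x|.
Proof. by rewrite /= expr0n addr0 sqrtr_sqr. Qed.

Lemma normc_nat (n : nat) : normc (n%:R : C) = n%:R.
Proof. by rewrite -[n%:R : C](rmorph_nat (real_complex R)) normc_real ger0_norm ?ler0n. Qed.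

Lemma normci : normc j = 1.
Proof. by rewrite /= expr0n expr1n add0r sqrtr1. Qed.

Lemma normcX (x : C) n : normc (x ^+ n) = normc x ^+ n.
Proof. by elim: n => [|n IH]; rewrite ?expr0 ?normc1 // !exprS normcM IH. Qed.

Lemma normc_sum (I : Type) (r : seq I) (F : I -> C) :
  normc (\sum_(i <- r) F i) <= \sum_(i <- r) normc (F i).
Proof.
elim: r => [|a r IH]; first by rewrite !big_nil normc0.
by rewrite !big_cons (le_trans (normcD _ _)) // lerD2l.
Qed.

Lemma mulii : j * j = -1. Proof. by rewrite -expr2 sqr_i. Qed.

(** Norms in R[i] are elements of R[i], which is only partially ordered; all
    estimates are therefore made on the real-valued modulus [normc]. *)
Lemma norm_normc (z : C) : `|z| = (normc z)%:C%C.
Proof. by case: z. Qed.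

Lemma normc_sq (z : C) : normc z ^+ 2 = complex.Re z ^+ 2 + complex.Im z ^+ 2.
Proof. by case: z => a b; rewrite /= sqr_sqrtr // addr_ge0 ?sqr_ge0. Qed.

Lemma normc_conj (z : C) : normc (z^*)%C = normc z.
Proof. by case: z => a b; rewrite /= sqrrN. Qed.

Lemma real_imagE (u v : R) : u%:C%C + j * v%:C%C = (u +i* v)%C.
Proof. by rewrite [RHS]complexE. Qed.

Lemma normc_ge_re (u v : R) : `|u| <= normc (u%:C%C + j * v%:C%C).
Proof.
rewrite real_imagE /= -sqrtr_sqr ler_wsqrtr // lerDl; exact: sqr_ge0.
Qed.

Lemma normc_ge_im (u v : R) : `|v| <= normc (u%:C%C + j * v%:C%C).
Proof.
rewrite real_imagE /= -sqrtr_sqr ler_wsqrtr // lerDr; exact: sqr_ge0.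
Qed.

End ComplexNorm.

(** * Trapezoid sums along squares *)

Section TrapezoidSums.
Variable R : realType.
Notation C := R[i].
Implicit Types (g : C -> C) (p V z c : C) (N m : nat).
Notation j := ('i%C : C).

(** The trapezoid rule with N steps for the integral of g along the segment
    from p to p + V. *)
Definition trapezoid g p V N : C :=
  \sum_(k < N) (g (p + (k%:R / N%:R) * V) + g (p + (k.+1%:R / N%:R) * V))
     / 2%:R * (V / N%:R).

(** The trapezoid rule for the integral of g along the positively oriented
    boundary of the square with vertex p and sides V and iV.  The side V is any
    complex number, so that the four quadrants around a point are treated
    alike. *)
Definition boundary_sum g p V N : C :=
  trapezoid g p V N + trapezoid g (p + V) (j * V) N
  - trapezoid g (p + j * V) V N - trapezoid g p (j * V) N.

Lemma trapezoid_split g p V N : (0 < N)%N ->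
  trapezoid g p V (2 * N) =
  trapezoid g p (V / 2%:R) N + trapezoid g (p + V / 2%:R) (V / 2%:R) N.
Proof.
move=> N0; have Nn : (N%:R : C) != 0 by rewrite pnatr_eq0 -lt0n.
have tn : (2%:R : C) != 0 by rewrite pnatr_eq0.
rewrite /trapezoid mul2n -addnn big_split_ord /=.
congr (_ + _); apply: eq_bigr => k _.
  congr ((g _ + g _) / _ * _); rewrite addnn -mul2n natrM; by field; rewrite ?Nn ?tn /=.
rewrite addnn -mul2n -addnS natrM !(natrD _ N).
congr ((g _ + g _) / _ * _); by field; rewrite ?Nn ?tn.
Qed.

Lemma boundary_sum_split g p V N : (0 < N)%N ->
  boundary_sum g p V (2 * N) =
    boundary_sum g p (V / 2%:R) N + boundary_sum g (p + V / 2%:R) (V / 2%:R) N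
    + boundary_sum g (p + j * (V / 2%:R)) (V / 2%:R) N
    + boundary_sum g (p + V / 2%:R + j * (V / 2%:R)) (V / 2%:R) N.
Proof.
move=> N0; rewrite /boundary_sum !trapezoid_split // -!mulrA.
set W := V / 2%:R; have VW : V = W + W by rewrite /W; field.
have -> : p + V = p + W + W by rewrite VW; ring.
have -> : p + j * V = p + j * W + j * W by rewrite VW; ring.
have -> : p + W + W + j * W = p + W + j * W + W by ring.
have -> : p + j * W + j * W + W = p + W + j * W + j * W by ring.
have -> : p + j * W + W = p + W + j * W by ring.
ring.
Qed.

Lemma trapezoidD g1 g2 p V N : trapezoid (fun z => g1 z + g2 z) p V N =
  trapezoid g1 p V N + trapezoid g2 p V N.
Proof. by rewrite /trapezoid -big_split; apply: eq_bigr => k _ /=; ring. Qed.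

Lemma trapezoidZ a g p V N :
  trapezoid (fun z => a * g z) p V N = a * trapezoid g p V N.
Proof. by rewrite /trapezoid mulr_sumr; apply: eq_bigr => k _ /=; ring. Qed.

Lemma boundary_sumD g1 g2 p V N : boundary_sum (fun z => g1 z + g2 z) p V N =
  boundary_sum g1 p V N + boundary_sum g2 p V N.
Proof. by rewrite /boundary_sum !trapezoidD; ring. Qed.

Lemma eq_trapezoid g1 g2 p V N : g1 =1 g2 -> trapezoid g1 p V N = trapezoid g2 p V N.
Proof. by move=> e; apply: eq_bigr => k _; rewrite !e. Qed.

(** The trapezoid rule is exact on affine functions: the sum telescopes to
    the increment of a primitive. *)
Lemma trapezoid_affine a b p V N : (0 < N)%N ->
  trapezoid (fun z => a + b * z) p V N =
  (a * (p + V) + b / 2%:R * (p + V) ^+ 2) - (a * p + b / 2%:R * p ^+ 2).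
Proof.
move=> N0; have Nn : (N%:R : C) != 0 by rewrite pnatr_eq0 -lt0n.
pose F k : C := let z := p + (k%:R / N%:R) * V in a * z + b / 2%:R * z ^+ 2.
transitivity (\sum_(0 <= k < N) (F k.+1 - F k)).
  rewrite big_mkord; apply: eq_bigr => k _; rewrite /F -natr1; field.
  by rewrite Nn.
by rewrite telescope_sumr // /F divff // mul1r mul0r mul0r addr0.
Qed.

Lemma boundary_sum_affine a b p V N : (0 < N)%N ->
  boundary_sum (fun z => a + b * z) p V N = 0.
Proof. by move=> N0; rewrite /boundary_sum !trapezoid_affine //; ring. Qed.

Lemma trapezoid_bound g p V N M : (0 < N)%N ->
  (forall x : R, 0 <= x <= 1 -> normc (g (p + x%:C%C * V)) <= M) ->
  normc (trapezoid g p V N) <= M * normc V.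
Proof.
move=> N0 H; have Nn : (N%:R : R) != 0 by rewrite pnatr_eq0 -lt0n.
apply: (le_trans (normc_sum _ _)).
have -> : M * normc V = \sum_(k < N) (M * normc V / N%:R).
  by rewrite sumr_const card_ord -[RHS]mulr_natr divfK.
apply: ler_sum => k _; rewrite !normcM !normcV !normc_nat.
have P (l : nat) : (l <= N)%N -> normc (g (p + l%:R / N%:R * V)) <= M.
  move=> lN; have := H (l%:R / N%:R); rewrite rmorphM fmorphV /= !rmorph_nat; apply.
  by rewrite divr_ge0 ?ler0n //= ler_pdivrMr ?ltr0n // mul1r ler_nat.
rewrite mulrA ler_wpM2r ?invr_ge0 ?ler0n // ler_wpM2r ?normc_ge0 //.
rewrite ler_pdivrMr ?ltr0n // (le_trans (normcD _ _)) //.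
have := P k (ltnW (ltn_ord k)); have := P k.+1 (ltn_ord k); lra.
Qed.

Definition in_square p V z := exists x y : R, [/\ 0 <= x <= 1, 0 <= y <= 1 &
  z = p + (x%:C%C + j * y%:C%C) * V].

Lemma in_square_corner p V : in_square p V p.
Proof.
by exists 0, 0; split; rewrite ?lexx ?ler01 //; rewrite rmorph0 mulr0 addr0 mul0r addr0.
Qed.

Lemma boundary_sum_bound g p V N M : (0 < N)%N ->
  (forall z, in_square p V z -> normc (g z) <= M) ->
  normc (boundary_sum g p V N) <= 4%:R * M * normc V.
Proof.
move=> N0 H.
have E q : (forall x : R, 0 <= x <= 1 -> in_square p V (q + x%:C%C * V)) ->
    normc (trapezoid g q V N) <= M * normc V.
  by move=> Hq; apply: trapezoid_bound => // x hx; apply/H/Hq.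
have E' q : (forall x : R, 0 <= x <= 1 -> in_square p V (q + x%:C%C * (j * V))) ->
    normc (trapezoid g q (j * V) N) <= M * normc V.
  move=> Hq; have -> : M * normc V = M * normc (j * V) by rewrite normcM normci mul1r.
  by apply: trapezoid_bound => // x hx; apply/H/Hq.
have i01 : 0 <= (0 : R) <= 1 by rewrite lexx ler01.
have i11 : 0 <= (1 : R) <= 1 by rewrite lexx ler01.
have e1 : normc (trapezoid g p V N) <= M * normc V.
  apply: E => x hx; exists x, 0; split => //; rewrite rmorph0; ring.
have e2 : normc (trapezoid g (p + V) (j * V) N) <= M * normc V.
  apply: E' => x hx; exists 1, x; split => //; rewrite rmorph1; ring.
have e3 : normc (trapezoid g (p + j * V) V N) <= M * normc V.
  apply: E => x hx; exists x, 1; split => //; rewrite rmorph1; ring.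
have e4 : normc (trapezoid g p (j * V) N) <= M * normc V.
  apply: E' => x hx; exists 0, x; split => //; rewrite rmorph0; ring.
rewrite /boundary_sum; apply: (le_trans (normcB _ _)).
have := normcB (trapezoid g p V N + trapezoid g (p + V) (j * V) N) (trapezoid g (p + j * V) V N).
have := normcD (trapezoid g p V N) (trapezoid g (p + V) (j * V) N).
lra.
Qed.

Lemma in_square_dist p V z c : in_square p V z -> in_square p V c ->
  normc (z - c) <= 2%:R * normc V.
Proof.
move=> [x [y [hx hy ->]]] [x' [y' [hx' hy' ->]]].
have -> : p + (x%:C%C + j * y%:C%C) * V - (p + (x'%:C%C + j * y'%:C%C) * V) =
   ((x - x')%:C%C + j * (y - y')%:C%C) * V by rewrite !rmorphB /=; ring.
rewrite normcM ler_wpM2r ?normc_ge0 // (le_trans (normcD _ _)) //.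
rewrite normcM normci mul1r !normc_real.
have : `|x - x'| <= 1 by rewrite ler_norml; lra.
have : `|y - y'| <= 1 by rewrite ler_norml; lra.
lra.
Qed.

End TrapezoidSums.

(** * Complex derivability in terms of real inequalities *)

Section ComplexDerivability.
Variable R : realType.
Notation C := R[i].
Lemma derivable_line n (F : 'rV[C]_n -> C) (p q : 'rV[C]_n) z :
  differentiable F (p + z *: q) -> derivable (fun x : C => F (p + x *: q)) z 1.
Proof.
move=> /diff_derivable => /(_ q) H.
rewrite /derivable in H *.
rewrite (_ : (fun h => _) = (fun h => h^-1 *:
  ((F \o shift (p + z *: q)) (h *: q) - F (p + z *: q)))) //.
apply/funext => h; congr (_ *: (_ - _)); rewrite /= scalerDl addrCA; congr F.
by rewrite /GRing.scale /= mulr1.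
Qed.
(** The epsilon-delta form of complex derivability, with real epsilon and
    delta, so that the estimates can be done in the ordered field R. *)
Definition cderivable (g : C -> C) c := exists b, forall e : R, 0 < e -> exists2 d : R, 0 < d &
  forall z, normc (z - c) < d -> normc (g z - g c - b * (z - c)) <= e * normc (z - c).

Lemma cderivableP (f : C -> C) z : derivable f z 1 <-> cderivable f z.
Proof.
split.
  move=> /cvg_ex[/= b].
  move=> /cvgrPdist_le H; exists b => e e0.
  have ec0 : (0 : C) < e%:C%C by rewrite ltcR.
  have := H _ ec0.
  rewrite near_withinE => /nbhs_norm0P[d /= d0 Hd].
  have dE : d = (complex.Re d)%:C%C by rewrite RRe_real // gtr0_real.
  exists (complex.Re d); first by rewrite -ltcR -dE.
  move=> w wz; have [->|wz0] := eqVneq w z.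
    by rewrite !subrr mulr0 subr0 normc0 mulr0.
  have {}wz0 : w - z != 0 by rewrite subr_eq0.
  have := Hd (w - z); rewrite /= norm_normc dE ltcR wz => /(_ isT wz0).
  rewrite [`|_|]norm_normc lecR /GRing.scale /= mulr1 subrK => HH.
  have -> : f w - f z - b * (w - z) = (b - (w - z)^-1 * (f w - f z)) * (z - w).
    by field.
  by rewrite normcM (normc_dist z) ler_wpM2r // normc_ge0.
move=> [b Hb]; apply/cvg_ex; exists b; apply/cvgrPdist_le => e e0.
have eE : e = (complex.Re e)%:C%C by rewrite RRe_real // gtr0_real.
have [|d d0 Hd] := Hb (complex.Re e); first by rewrite -ltcR -eE.
rewrite near_withinE; apply/nbhs_norm0P; exists d%:C%C; first by rewrite /= ltcR.
move=> h /=; rewrite norm_normc ltcR => hd h0.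
rewrite [`|_|]norm_normc eE lecR /GRing.scale /= mulr1.
have n0 : 0 < normc h.
  by rewrite normc_gt0.
have := Hd (h + z); rewrite addrK => /(_ hd); rewrite -ler_pdivrMr // => hq.
apply: le_trans hq.
rewrite -normcV -normcM -normcN.
rewrite le_eqVlt; apply/orP; left; apply/eqP; congr normc; by field.
Qed.

Lemma cderivableM (f g : C -> C) z :
  cderivable f z -> cderivable g z -> cderivable (fun x => f x * g x) z.
Proof.
by move=> /cderivableP hf /cderivableP hg; apply/cderivableP; exact: (derivableM hf hg).
Qed.

Lemma cderivableB (f g : C -> C) z :
  cderivable f z -> cderivable g z -> cderivable (fun x => f x - g x) z.
Proof.
by move=> /cderivableP hf /cderivableP hg; apply/cderivableP; exact: (derivableB hf hg).
Qed.

Lemma cderivableV (f : C -> C) z :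
  cderivable f z -> f z != 0 -> cderivable (fun x => (f x)^-1) z.
Proof. by move=> /cderivableP hf fz; apply/cderivableP; exact: (derivableV fz hf). Qed.

Lemma cderivable_id z : cderivable (fun x : C => x) z.
Proof. by apply/cderivableP; exact: derivable_id. Qed.

Lemma cderivable_cst (a : C) z : cderivable (fun x : C => a) z.
Proof. by apply/cderivableP; exact: derivable_cst. Qed.

Lemma cderivableX (f : C -> C) z n :
  cderivable f z -> cderivable (fun x => f x ^+ n) z.
Proof.
move=> hf; elim: n => [|n IH].
  by under eq_fun do rewrite expr0; exact: cderivable_cst.
by under eq_fun do rewrite exprS; exact: cderivableM.
Qed.

End ComplexDerivability.

(** * Goursat's theorem by bisection *)

Section Goursat.
Variable R : realType.
Notation C := R[i].
Implicit Types (g : C -> C) (p V z c : C) (N m : nat).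
Notation j := ('i%C : C).

Lemma nested_intervals (x h : nat -> R) :
  (forall n, x n <= x n.+1) -> (forall n, x n.+1 + h n.+1 <= x n + h n) ->
  (forall n, 0 <= h n) -> exists l : R, forall n, x n <= l <= x n + h n.
Proof.
move=> xi yd h0.
have xm : {homo x : m n / (m <= n)%N >-> m <= n} by apply: homo_leq => //; apply: le_trans.
have ym : {homo (fun n => x n + h n) : m n / (m <= n)%N >-> n <= m}.
  by apply: homo_leq => // a b d ab bd; apply: le_trans bd ab.
have bnd m n : x m <= x n + h n.
  have [mn|nm] := leqP m n; first by rewrite (le_trans (xm _ _ mn)) // lerDl.
  by rewrite (le_trans _ (ym _ _ (ltnW nm))) // lerDl.
exists (sup (range x)) => n; apply/andP; split.
  apply: ub_le_sup; last by exists n.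
  by exists (x 0%N + h 0%N) => _ [m _ <-].
by apply: ge_sup; [exists (x 0%N), 0%N | move=> _ [m _ <-]].
Qed.

Lemma half_pow_lt (a d : R) : 0 < d -> exists n, a / 2%:R ^+ n < d.
Proof.
move=> d0; exists (Num.bound (a / d)).
rewrite ltr_pdivrMr ?exprn_gt0 ?ltr0n // mulrC -ltr_pdivrMr //.
by apply: upper_nthrootP.
Qed.

(** Cousin's lemma for squares: a property that passes from the four quarters
    of a square to the square, and that holds for small squares around each
    point, holds for the whole square.  Otherwise bisection yields nested
    squares without the property, shrinking to a point. *)
Lemma square_bisection (P : C -> C -> Prop) (p V : C) :
  (forall q W, P q (W / 2%:R) -> P (q + W / 2%:R) (W / 2%:R) ->
     P (q + j * (W / 2%:R)) (W / 2%:R) ->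
     P (q + W / 2%:R + j * (W / 2%:R)) (W / 2%:R) -> P q W) ->
  (forall c, in_square p V c -> exists2 d : R, 0 < d & forall q W, in_square q W c ->
     normc W < d -> P q W) ->
  P p V.
Proof.
move=> Pglue Ploc; apply: contrapT => nP.
have step (qW : C * C) : exists ab : bool * bool, ~ P qW.1 qW.2 ->
    ~ P (qW.1 + (ab.1%:R + j * ab.2%:R) * (qW.2 / 2%:R)) (qW.2 / 2%:R).
  case: qW => q W /=; apply: contrapT => H; apply: (H).
  have K (ab : bool * bool) : P (q + (ab.1%:R + j * ab.2%:R) * (W / 2%:R)) (W / 2%:R).
    by apply: contrapT => nPab; apply: H; exists ab.
  exists (false, false) => nPq; exfalso; apply: nPq; apply: Pglue.
  - by have := K (false, false); rewrite mulr0 addr0 mul0r addr0.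
  - by have := K (true, false); rewrite mulr0 addr0 mul1r.
  - by have := K (false, true); rewrite mulr1 add0r.
  - by have := K (true, true); rewrite mulr1 mulrDl mul1r addrA.
have {step}[s Hs] := choice step.
pose Q (xy : R * R) : C := p + (xy.1%:C%C + j * xy.2%:C%C) * V.
(* [F n] holds the coordinates of the vertex of the n-th square, relative to
   the initial one; [s] selects the quarter that violates P. *)
pose W n : C := V / 2%:R ^+ n.
pose F := fix F n : R * R := if n is k.+1 then
  ((F k).1 + (s (Q (F k), W k)).1%:R / 2%:R ^+ k.+1,
   (F k).2 + (s (Q (F k), W k)).2%:R / 2%:R ^+ k.+1) else (0, 0).
have pw n : (2%:R ^+ n : R) != 0 by rewrite expf_neq0 // pnatr_eq0.
have pwC n : (2%:R ^+ n : C) != 0 by rewrite expf_neq0 // pnatr_eq0.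
have tC : (2%:R : C) != 0 by rewrite pnatr_eq0.
have bad n : ~ P (Q (F n)) (W n).
  elim: n => [|n /(Hs (Q (F n), W n))].
    by rewrite /Q /W /= rmorph0 mulr0 addr0 mul0r addr0 expr0 divr1.
  rewrite [(_, _).1]/= [(_, _).2]/=.
  have -> : W n / 2%:R = W n.+1 by rewrite /W exprS; field; rewrite ?tC ?pwC.
  congr (~ P _ _); rewrite /Q /=.
  rewrite !rmorphD !rmorphM /= !fmorphV !rmorphXn /= !rmorph_nat /W.
  by rewrite exprS; field; rewrite ?tC ?pwC.
pose h n : R := (2%:R ^+ n)^-1.
have h0 n : 0 <= h n by rewrite invr_ge0 exprn_ge0 // ler0n.
have hS n : h n = h n.+1 + h n.+1.
  by rewrite /h exprS; field; rewrite ?pw ?pnatr_eq0.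
have b01 (b : bool) : 0 <= (b%:R : R) <= 1 by case: b; rewrite ?lexx ?ler01.
have [cx Hx] : exists l : R, forall n, (F n).1 <= l <= (F n).1 + h n.
  apply: nested_intervals => // n /=; rewrite -/(h n.+1).
    by rewrite lerDl mulr_ge0 ?h0 //; case/andP: (b01 (s (Q (F n), W n)).1).
  rewrite [X in _ <= _ + X]hS -addrA lerD2l lerD2r ler_piMl //.
  by case/andP: (b01 (s (Q (F n), W n)).1).
have [cy Hy] : exists l : R, forall n, (F n).2 <= l <= (F n).2 + h n.
  apply: nested_intervals => // n /=; rewrite -/(h n.+1).
    by rewrite lerDl mulr_ge0 ?h0 //; case/andP: (b01 (s (Q (F n), W n)).2).
  rewrite [X in _ <= _ + X]hS -addrA lerD2l lerD2r ler_piMl //.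
  by case/andP: (b01 (s (Q (F n), W n)).2).
pose c := Q (cx, cy).
have cin n : in_square (Q (F n)) (W n) c.
  have e01 (u v : R) : u <= v <= u + h n -> 0 <= (v - u) * 2%:R ^+ n <= 1.
    move=> /andP[uv vu]; rewrite mulr_ge0 ?subr_ge0 ?exprn_ge0 ?ler0n //=.
    by rewrite -ler_pdivlMr ?exprn_gt0 ?ltr0n // div1r lerBlDl.
  exists ((cx - (F n).1) * 2%:R ^+ n), ((cy - (F n).2) * 2%:R ^+ n); split.
  - exact: e01.
  - exact: e01.
  rewrite /c /Q /W /= !rmorphM !rmorphB !rmorphXn /= !rmorph_nat.
  by field.
have [|d d0 Hd] := Ploc c.
  by have := cin 0%N; rewrite /Q /W /= rmorph0 mulr0 addr0 mul0r addr0 expr0 divr1.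
have [n Hn] := half_pow_lt (normc V) d0.
apply: (bad n); apply: Hd => //.
by rewrite /W normcM normcV normcX normc_nat.
Qed.

(** Bisection applied to the bound eta |W|^2, which is additive over the
    four quarters: near a point c, g differs from its affine approximation,
    whose boundary sum is 0, by a small multiple of the size |W| of the
    square, and the boundary has length 4 |W|. *)
Lemma goursat g p V e : 0 < e -> (forall c, in_square p V c -> cderivable g c) ->
  exists m0, forall m, (m0 <= m)%N -> normc (boundary_sum g p V (2 ^ m)) <= e.
Proof.
move=> e0 gd.
(* The 1 covers the case V = 0. *)
pose eta := e / (normc V ^+ 2 + 1).
have V1 : 0 < normc V ^+ 2 + 1 by have := sqr_ge0 (normc V); lra.
have eta0 : 0 < eta by rewrite divr_gt0.
have [m0 Hm0] : exists m0, forall m, (m0 <= m)%N ->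
    normc (boundary_sum g p V (2 ^ m)) <= eta * normc V ^+ 2.
  apply: (@square_bisection (fun q W => exists m0, forall m, (m0 <= m)%N ->
    normc (boundary_sum g q W (2 ^ m)) <= eta * normc W ^+ 2)).
    move=> q W [m1 H1] [m2 H2] [m3 H3] [m4 H4].
    exists (maxn (maxn m1 m2) (maxn m3 m4)).+1 => -[//|m].
    rewrite ltnS !geq_max => /andP[/andP[l1 l2] /andP[l3 l4]].
    rewrite expnS boundary_sum_split ?expn_gt0 //.
    have := H1 _ l1; have := H2 _ l2; have := H3 _ l3; have := H4 _ l4.
    rewrite normcM normcV normc_nat.
    set A := boundary_sum _ _ _ _; set B := boundary_sum _ _ _ _.
    set D := boundary_sum _ _ _ _; set E := boundary_sum _ _ _ _ => hA hB hD hE.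
    apply: le_trans (normcD _ _) _; apply: le_trans (lerD (normcD _ _) hA) _.
    have := normcD E D; rewrite expr_div_n in hA hB hD hE *; lra.
  move=> c /gd [b Hb]; have e80 : 0 < eta / 8%:R by rewrite divr_gt0 ?ltr0n.
  have [d d0 Hd] := Hb _ e80.
  exists (d / 2%:R); first by rewrite divr_gt0 ?ltr0n.
  move=> q W qWc Wd; exists 0%N => m _.
  have N0 : (0 < 2 ^ m)%N by rewrite expn_gt0.
  pose r z := g z - g c - b * (z - c).
  have -> : boundary_sum g q W (2 ^ m) = boundary_sum r q W (2 ^ m).
    rewrite -[RHS]addr0 -(boundary_sum_affine (g c - b * c) b q W N0) -boundary_sumD.
    by congr boundary_sum; apply/funext => z; rewrite /r; ring.
  apply: le_trans (@boundary_sum_bound _ r q W _ (eta / 8%:R * (2%:R * normc W)) N0 _) _.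
    move=> z qWz; have := in_square_dist qWz qWc; have := normc_ge0 W => w0 zc.
    apply: le_trans (Hd _ _) _; first by lra.
    by rewrite ler_wpM2l // ltW.
  by rewrite expr2; lra.
exists m0 => m /Hm0 /le_trans; apply; rewrite /eta -mulrA ler_piMr //; first exact: ltW.
by rewrite mulrC ltW // ltr_pdivrMr //; lra.
Qed.

(** An exceptional vertex b at which g is only bounded is harmless: after k
    bisections all quarters but the one at b fall under [goursat], and the last
    one has boundary length 4 |V| / 2^k. *)
Lemma goursat_corner g b V (M d : R) k : V != 0 ->
  (forall c, in_square b V c -> c != b -> cderivable g c) ->
  (forall z, normc (z - b) < d -> normc (g z) <= M) ->
  2%:R * normc V / 2%:R ^+ k < d ->
  forall e : R, 0 < e -> exists m0, forall m, (m0 <= m)%N ->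
    normc (boundary_sum g b V (2 ^ m)) <= e + 4%:R * M * normc V / 2%:R ^+ k.
Proof.
move=> + + gM; elim: k V => [|k IH] V V0 gd Vd e e0.
  exists 0%N => m _; rewrite expr0 divr1.
  apply: le_trans (@boundary_sum_bound _ g b V _ M _ _) _; rewrite ?expn_gt0 //; last by lra.
  move=> z bz; apply: gM; apply: le_lt_trans (in_square_dist bz (in_square_corner _ _)) _.
  by move: Vd; rewrite expr0 divr1.
have tC : (2%:R : C) != 0 by rewrite pnatr_eq0.
have pw : (2%:R ^+ k : R) != 0 by rewrite expf_neq0 // pnatr_eq0.
set W := V / 2%:R.
have VW : V = W + W by rewrite /W; field.
have W0 : W != 0 by rewrite mulf_neq0 // invr_neq0.
have nW : normc V = 2%:R * normc W by rewrite /W normcM normcV normc_nat; field.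
have sub a1 a2 z : 0 <= (a1 : R) <= 1 -> 0 <= (a2 : R) <= 1 ->
    in_square (b + (a1%:C%C + j * a2%:C%C) * W) W z ->
    [/\ in_square b V z & (0 < a1 + a2) -> z != b].
  move=> ha1 ha2 [x [y [hx hy ->]]]; split.
    exists ((a1 + x) / 2%:R), ((a2 + y) / 2%:R); split; [lra|lra|].
    rewrite /W !rmorphM !rmorphD /= !fmorphV !rmorph_nat; by field.
  move=> a12; apply/eqP => E.
  have /eqP : ((a1 + x)%:C%C + j * (a2 + y)%:C%C) * W = 0.
    rewrite -(subrr b) -[X in _ = X - _]E !rmorphD /=; ring.
  rewrite mulf_eq0 (negbTE W0) orbF real_imagE eq_complex /= => /andP[/eqP u0 /eqP v0].
  lra.
have := sub 0 0; have := sub 1 0; have := sub 0 1; have := sub 1 1.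
have i01 : 0 <= (0 : R) <= 1 by rewrite lexx ler01.
have i11 : 0 <= (1 : R) <= 1 by rewrite lexx ler01.
rewrite !rmorph0 !rmorph1 !mulr0 !mulr1 !addr0 !mul0r !addr0 !add0r !mul1r.
rewrite mulrDl mul1r addrA.
move=> /(_ _ i11 i11) S11 /(_ _ i01 i11) S01 /(_ _ i11 i01) S10 /(_ _ i01 i01) S00.
have e40 : 0 < e / 4%:R by rewrite divr_gt0 ?ltr0n.
have [m1 H1] : exists m0, forall m, (m0 <= m)%N ->
    normc (boundary_sum g (b + W) W (2 ^ m)) <= e / 4%:R.
  by apply: goursat => // c /S10 [h1 h2]; apply: gd => //; apply: h2; lra.
have [m2 H2] : exists m0, forall m, (m0 <= m)%N ->
    normc (boundary_sum g (b + j * W) W (2 ^ m)) <= e / 4%:R.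
  by apply: goursat => // c /S01 [h1 h2]; apply: gd => //; apply: h2; lra.
have [m3 H3] : exists m0, forall m, (m0 <= m)%N ->
    normc (boundary_sum g (b + W + j * W) W (2 ^ m)) <= e / 4%:R.
  by apply: goursat => // c /S11 [h1 h2]; apply: gd => //; apply: h2; lra.
have [||m4 H4] := IH W W0 _ _ _ e40.
- by move=> c /S00 [h1 _]; apply: gd.
- apply: le_lt_trans Vd; rewrite nW exprS le_eqVlt; apply/orP; left; apply/eqP.
  by field.
exists (maxn (maxn m1 m2) (maxn m3 m4)).+1 => -[//|m].
rewrite ltnS !geq_max => /andP[/andP[l1 l2] /andP[l3 l4]].
rewrite expnS boundary_sum_split ?expn_gt0 // -/W.
have := H1 _ l1; have := H2 _ l2; have := H3 _ l3; have := H4 _ l4.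
have -> : 4%:R * M * normc V / 2%:R ^+ k.+1 = 4%:R * M * normc W / 2%:R ^+ k.
  by rewrite nW exprS; field.
set A := boundary_sum _ _ _ _; set B := boundary_sum _ _ _ _.
set D := boundary_sum _ _ _ _; set E := boundary_sum _ _ _ _ => hA hB hD hE.
have := normcD (A + E + D) B; have := normcD (A + E) D; have := normcD A E.
lra.
Qed.
End Goursat.

(** * A Cauchy estimate *)

Section CauchyEstimate.
Variable R : realType.
Notation C := R[i].
Implicit Types (f g : C -> C) (p V z c : C) (N m : nat).
Notation j := ('i%C : C).

Definition in_box b (r : R) z := exists x y : R, [/\ -1 <= x <= 1, -1 <= y <= 1 &
  z = b + (x%:C%C + j * y%:C%C) * r%:C%C].

Lemma in_box_dist b (r : R) z : 0 <= r -> in_box b r z -> normc (z - b) <= 2%:R * r.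
Proof.
move=> r0 [x [y [hx hy ->]]]; rewrite addrC addKr normcM normc_real (ger0_norm r0).
rewrite ler_wpM2r // (le_trans (normcD _ _)) // normcM normci mul1r !normc_real.
have : `|x| <= 1 by rewrite ler_norml.
have : `|y| <= 1 by rewrite ler_norml.
lra.
Qed.

Lemma in_box_square b (r : R) z : in_box b r z ->
  in_square (b - (1 + j) * r%:C%C) (2%:R * r%:C%C) z.
Proof.
move=> [x [y [hx hy ->]]]; exists ((x + 1) / 2%:R), ((y + 1) / 2%:R).
split; [lra|lra|].
rewrite !rmorphM !rmorphD /= !fmorphV !rmorph_nat.
have tC : (2%:R : C) != 0 by rewrite pnatr_eq0.
by field.
Qed.

(** The part of the boundary sum of a quadrant with vertex b that comes from the
    two sides away from b. *)
Definition outer_sum g b W N :=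
  trapezoid g (b + W) (j * W) N - trapezoid g (b + j * W) W N.

(** The sides issued from b are shared by neighbouring quadrants and run
    through in opposite directions, so they cancel. *)
Lemma four_quadrants g b W N :
  boundary_sum g b W N + boundary_sum g b (j * W) N
    + boundary_sum g b (- W) N + boundary_sum g b (- (j * W)) N =
  outer_sum g b W N + outer_sum g b (j * W) N
    + outer_sum g b (- W) N + outer_sum g b (- (j * W)) N.
Proof.
have jjW : j * (j * W) = - W by rewrite mulrA mulii mulN1r.
by rewrite /boundary_sum /outer_sum !mulrN !jjW !opprK; ring.
Qed.

(** A discrete winding number: on the sides 1 + ix and x + i of the unit
    quadrant the integrands i/(1 + ix) and -1/(x + i) add up to
    2i/(1 + x^2), and 2/(1 + x^2) >= 1 for x in [0, 1]. *)
Lemma outer_sum_cauchy_kernel b W N : (0 < N)%N -> W != 0 ->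
  exists2 T : R, 1 <= T & outer_sum (fun z => (z - b)^-1) b W N = j * T%:C%C.
Proof.
move=> N0 W0; have Nn : (N%:R : R) != 0 by rewrite pnatr_eq0 -lt0n.
have NnC : (N%:R : C) != 0 by rewrite pnatr_eq0 -lt0n.
have tC : (2%:R : C) != 0 by rewrite pnatr_eq0.
pose v k : R := 2%:R / (1 + (k%:R / N%:R) ^+ 2).
have x1 k : 0 < 1 + (k%:R / N%:R) ^+ 2 :> R.
  by have := sqr_ge0 ((k%:R / N%:R) : R); lra.
exists (\sum_(k < N) (v k + v k.+1) / 2%:R / N%:R).
  have S1 : \sum_(k < N) N%:R^-1 = 1 :> R.
    by rewrite sumr_const card_ord -[LHS]mulr_natr mulVf.
  rewrite -[leLHS]S1; apply: ler_sum => k _ /=; rewrite ler_peMl ?invr_ge0 ?ler0n //.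
  have vk l : (l <= N)%N -> 1 <= v l.
    move=> lN; rewrite /v ler_pdivlMr // mul1r.
    have : (l%:R / N%:R : R) ^+ 2 <= 1.
      rewrite expr_le1 ?divr_ge0 ?ler0n // ler_pdivrMr ?ltr0n // mul1r.
      by rewrite ler_nat.
    lra.
  have := vk k (ltnW (ltn_ord k)); have := vk k.+1 (ltn_ord k).
  by move: (v k) (v k.+1) => u w h1 h2; lra.
rewrite /outer_sum /trapezoid -sumrB rmorph_sum mulr_sumr; apply: eq_bigr => k _.
have pv l : j * (v l)%:C%C =
   j / (1 + j * (l%:R / N%:R)) - 1 / (j + l%:R / N%:R).
  pose x : R := l%:R / N%:R.
  have xE : (l%:R / N%:R : C) = x%:C%C by rewrite /x rmorphM fmorphV /= !rmorph_nat.
  have -> : (v l)%:C%C = 2%:R / (1 + x%:C%C ^+ 2).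
    by rewrite /v -/x rmorphM /= fmorphV /= rmorph_nat rmorphD /= rmorph1 rmorphXn.
  rewrite xE.
  have a0 : 1 + j * x%:C%C != 0.
    by rewrite -(rmorph1 (real_complex R)) real_imagE eq_complex /= oner_eq0.
  have b0 : j + x%:C%C != 0.
    rewrite addrC -[j]mulr1 -(rmorph1 (real_complex R)) real_imagE eq_complex /=.
    by rewrite oner_eq0 andbF.
  have c0 : 1 + x%:C%C ^+ 2 != 0.
    rewrite -(rmorph1 (real_complex R)) -rmorphXn -rmorphD /=.
    rewrite (_ : 0 = (0 : R)%:C%C) //.
    by apply/eqP => /complexI E; have := sqr_ge0 x; lra.
  have e1 : (1 + j * x%:C%C)^-1 = (1 - j * x%:C%C) / (1 + x%:C%C ^+ 2).
    apply: (mulIf a0); rewrite mulVf //; apply: (mulIf c0).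
    rewrite mul1r; field: (mulii R); exact: c0.
  have e2 : (j + x%:C%C)^-1 = (x%:C%C - j) / (1 + x%:C%C ^+ 2).
    apply: (mulIf b0); rewrite mulVf //; apply: (mulIf c0).
    rewrite mul1r; field: (mulii R); exact: c0.
  rewrite e1 e2; field: (mulii R); exact: c0.
rewrite !rmorphM !rmorphD !fmorphV /= !rmorph_nat.
have -> : j * (((v k)%:C%C + (v k.+1)%:C%C) / 2%:R / N%:R) =
  (j * (v k)%:C%C + j * (v k.+1)%:C%C) / 2%:R / N%:R by ring.
rewrite !pv.
have f1 l : b + W + l%:R / N%:R * (j * W) - b = W * (1 + j * (l%:R / N%:R)) by ring.
have f2 l : b + j * W + l%:R / N%:R * W - b = W * (j + l%:R / N%:R) by ring.
rewrite !f1 !f2 !invfM.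
set A1 := (1 + _)^-1; set A2 := (1 + _)^-1; set B1 := (j + _)^-1; set B2 := (j + _)^-1.
by field; rewrite ?W0 ?NnC ?tC.
Qed.

Lemma quadrant_in_box b (r : R) W z :
  W \in [:: r%:C%C; j * r%:C%C; - r%:C%C; - (j * r%:C%C)] ->
  in_square b W z -> in_box b r z.
Proof.
rewrite !inE => H [x [y [hx hy ->]]].
have [x' [y' [hx' hy' E]]] : exists x' y' : R, [/\ -1 <= x' <= 1, -1 <= y' <= 1 &
    (x%:C%C + j * y%:C%C) * W = (x'%:C%C + j * y'%:C%C) * r%:C%C].
  case/or4P: H => /eqP ->.
  - by exists x, y; split; [lra|lra|].
  - by exists (- y), x; split; [lra|lra|]; rewrite rmorphN /=; ring: (mulii R).
  - by exists (- x), (- y); split; [lra|lra|]; rewrite !rmorphN /=; ring.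
  - by exists y, (- x); split; [lra|lra|]; rewrite rmorphN /=; ring: (mulii R).
by exists x', y'; split => //; rewrite E.
Qed.

Lemma cderivable_locally_bounded g c : cderivable g c -> exists M, exists2 d : R, 0 < d &
  forall z, normc (z - c) < d -> normc (g z) <= M.
Proof.
move=> [b /(_ 1 ltr01)[d d0 Hd]].
exists (normc (g c) + (normc b + 1) * d); exists d => // z zd.
have := Hd z zd; have := normc_ge0 b => b0 hw.
have -> : g z = g c + (b * (z - c) + (g z - g c - b * (z - c))) by ring.
set w := (X in normc X <= _) in hw *.
have h1 := normcD (g c) (b * (z - c) + w).
have h2 := normcD (b * (z - c)) w; rewrite normcM in h2.
have h3 : normc b * normc (z - c) <= normc b * d by rewrite ler_wpM2l // ltW.
lra.
Qed.

(** The boundary sums of (f z - f b)/(z - b) over the four quadrants around b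
    tend to 0 by [goursat_corner].  Their outer parts compare f b times a
    winding number of modulus at least 4 with the boundary values of
    f z/(z - b), at most M/r, along sides of total length 8r.  The constant
    2 will disappear when the estimate is applied to powers. *)
Lemma cauchy_estimate f b (r M : R) : 0 < r ->
  (forall z, in_box b r z -> cderivable f z) ->
  (forall z, in_box b r z -> r <= normc (z - b) -> normc (f z) <= M) ->
  normc (f b) <= 2%:R * M.
Proof.
move=> r0 fd fM.
have rC : (r%:C%C : C) != 0 by apply/eqP => /complexI E; rewrite E ltxx in r0.
pose W4 := [:: r%:C%C; j * r%:C%C; - r%:C%C; - (j * r%:C%C)].
have W4n W : W \in W4 -> normc W = r.
  rewrite !inE => /or4P[] /eqP ->; rewrite ?normcN ?normcM ?normci ?mul1r normc_real;
  by rewrite ger0_norm // ltW.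
have W4j W : W \in W4 -> W != 0.
  move=> /W4n E; apply/eqP => W0; move: E; rewrite W0 normc0 => E.
  by rewrite -E ltxx in r0.
pose k z := (z - b)^-1.
pose phi z := (f z - f b) * k z.
have bb : in_box b r b.
  exists 0, 0; split; [lra|lra|]; by rewrite rmorph0 mulr0 addr0 mul0r addr0.
(* [phi] is 0 at b rather than the derivative of f: only its boundedness
   near b is used. *)
have phid c : in_box b r c -> c != b -> cderivable phi c.
  move=> bc cb; apply: (@cderivableM _ (fun z => f z - f b) k).
    by apply: cderivableB; [exact: fd|exact: cderivable_cst].
  apply: cderivableV; last by rewrite subr_eq0.
  apply: cderivableB; [exact: cderivable_id|exact: cderivable_cst].
have [M1 [d d0 phiM]] : exists M1, exists2 d : R, 0 < d &
   forall z, normc (z - b) < d -> normc (phi z) <= M1.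
  have [a /(_ 1 ltr01)[d d0 Hd]] := fd b bb.
  exists (normc a + 1), d => // z zd.
  have [->|zb] := eqVneq z b.
    by rewrite /phi subrr mul0r normc0; have := normc_ge0 a; lra.
  have zb0 : 0 < normc (z - b) by rewrite normc_gt0 subr_eq0.
  rewrite /phi /k normcM normcV ler_pdivrMr //.
  have -> : f z - f b = a * (z - b) + (f z - f b - a * (z - b)) by ring.
  rewrite (le_trans (normcD _ _)) // normcM mulrDl lerD2l; exact: Hd.
suff H e : 0 < e -> normc (f b) <= 2%:R * M + 2%:R * e.
  apply/ler_addgt0Pr => e e0; have := H (e / 2%:R); lra.
move=> e0.
have M10 : 0 <= M1.
  by apply: le_trans (normc_ge0 (phi b)) (phiM _ _); rewrite subrr normc0.
have e10 : 0 < Num.min d (e / (2%:R * (M1 + 1))).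
  by rewrite lt_min d0 divr_gt0 // mulr_gt0 ?ltr0n //; lra.
have [n] := half_pow_lt (2%:R * r) e10; rewrite lt_min => /andP[nd ne].
have M1e : 4%:R * M1 * r / 2%:R ^+ n <= e.
  have -> : 4%:R * M1 * r / 2%:R ^+ n = 2%:R * M1 * (2%:R * r / 2%:R ^+ n) by ring.
  apply: (@le_trans _ _ (2%:R * M1 * (e / (2%:R * (M1 + 1))))).
    by apply: ler_wpM2l (ltW ne); lra.
  have -> : 2%:R * M1 * (e / (2%:R * (M1 + 1))) = e * (M1 / (M1 + 1)).
    by field; rewrite gt_eqF //; lra.
  by rewrite ler_piMr ?(ltW e0) // ler_pdivrMr; lra.
have small W : W \in W4 -> exists m0, forall m, (m0 <= m)%N ->
    normc (boundary_sum phi b W (2 ^ m)) <= 2%:R * e.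
  move=> WW; have [||m0 Hm0] := @goursat_corner _ phi b W M1 d n (W4j W WW) _ phiM _ e e0.
  - by move=> c /(quadrant_in_box WW); apply: phid.
  - by rewrite (W4n _ WW).
  exists m0 => m /Hm0; rewrite (W4n _ WW); lra.
have [i1 i2 i3 i4] : [/\ r%:C%C \in W4, j * r%:C%C \in W4, - r%:C%C \in W4 &
    - (j * r%:C%C) \in W4] by rewrite !inE !eqxx !orbT.
have [m1 H1] := small _ i1; have [m2 H2] := small _ i2.
have [m3 H3] := small _ i3; have [m4 H4] := small _ i4.
pose m := (maxn (maxn m1 m2) (maxn m3 m4)).
have [l1 l2 l3 l4] : [/\ (m1 <= m)%N, (m2 <= m)%N, (m3 <= m)%N & (m4 <= m)%N].
  have := leqnn m; rewrite {1}/m !geq_max => /andP[/andP[? ?] /andP[? ?]].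
  by split.
have {}H1 := H1 _ l1; have {}H2 := H2 _ l2; have {}H3 := H3 _ l3; have {}H4 := H4 _ l4.
have N0 : (0 < 2 ^ m)%N by rewrite expn_gt0.
have outerM W : W \in W4 -> normc (outer_sum (fun z => f z * k z) b W (2 ^ m)) <= 2%:R * M.
  move=> WW; have nW := W4n _ WW.
  have fk z : in_box b r z -> r <= normc (z - b) -> normc (f z * k z) <= M / r.
    move=> bz rz; rewrite normcM normcV.
    have zb0 := lt_le_trans r0 rz.
    apply: ler_pM; rewrite ?normc_ge0 ?invr_ge0 ?normc_ge0 //; first exact: fM.
    by rewrite lef_pV2 ?posrE.
  have Mr : M = M / r * normc W by rewrite nW divfK // gt_eqF.
  have MrJ : M = M / r * normc (j * W) by rewrite normcM normci mul1r.
  apply: le_trans (normcB _ _) _; rewrite mulrDl mul1r; apply: lerD.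
    rewrite [leRHS]MrJ; apply: trapezoid_bound => // x hx.
    have E : b + W + x%:C%C * (j * W) = b + (1%:C%C + j * x%:C%C) * W.
      by rewrite rmorph1; ring.
    rewrite E; apply: fk.
      apply: (quadrant_in_box WW); exists 1, x; split => //; lra.
    rewrite addrC addKr normcM nW ler_peMl ?(ltW r0) //.
    by apply: le_trans (normc_ge_re _ _); rewrite normr1.
  rewrite [leRHS]Mr; apply: trapezoid_bound => // x hx.
  have E : b + j * W + x%:C%C * W = b + (x%:C%C + j * 1%:C%C) * W.
    by rewrite rmorph1; ring.
  rewrite E; apply: fk.
    apply: (quadrant_in_box WW); exists x, 1; split => //; lra.
  rewrite addrC addKr normcM nW ler_peMl ?(ltW r0) //.
  by apply: le_trans (normc_ge_im _ _); rewrite normr1.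
have phiE W : outer_sum phi b W (2 ^ m) =
    outer_sum (fun z => f z * k z) b W (2 ^ m) + - f b * outer_sum k b W (2 ^ m).
  rewrite /outer_sum mulrBr -!trapezoidZ.
  have E q U : trapezoid phi q U (2 ^ m) = trapezoid (fun z => f z * k z) q U (2 ^ m) +
       trapezoid (fun z => - f b * k z) q U (2 ^ m).
    by rewrite -trapezoidD; apply: eq_trapezoid => z; rewrite /phi; ring.
  by rewrite !E; ring.
have out W : W \in W4 -> exists2 T : R, 1 <= T &
    outer_sum phi b W (2 ^ m) = outer_sum (fun z => f z * k z) b W (2 ^ m) - f b * j * T%:C%C.
  move=> WW; have [T T1 HT] := outer_sum_cauchy_kernel b N0 (W4j _ WW).
  by exists T => //; rewrite phiE HT; ring.
have [T1 T11 O1] := out _ i1; have [T2 T21 O2] := out _ i2.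
have [T3 T31 O3] := out _ i3; have [T4 T41 O4] := out _ i4.
have {i1 i2 i3 i4} [P1 P2 P3 P4] := And4 (outerM _ i1) (outerM _ i2) (outerM _ i3) (outerM _ i4).
have := four_quadrants phi b r%:C%C (2 ^ m); rewrite O1 O2 O3 O4.
move: (boundary_sum _ _ _ _) H1 (boundary_sum _ _ _ _) H2.
move: (boundary_sum _ _ _ _) H3 (boundary_sum _ _ _ _) H4.
move: (outer_sum _ _ _ _) P1 (outer_sum _ _ _ _) P2 (outer_sum _ _ _ _) P3 (outer_sum _ _ _ _) P4.
move=> o1 P1 o2 P2 o3 P3 o4 P4 b3 H3 b4 H4 b1 H1 b2 H2 EE.
have : f b * j * (T1 + T2 + T3 + T4)%:C%C = (o1 + o2 + o3 + o4) - (b1 + b2 + b3 + b4).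
  by rewrite EE !rmorphD /=; ring.
move/(congr1 (@normc R)); rewrite !normcM normci mulr1 normc_real ger0_norm; last by lra.
have := normcB (o1 + o2 + o3 + o4) (b1 + b2 + b3 + b4).
have := normcD (o1 + o2 + o3) o4; have := normcD (o1 + o2) o3; have := normcD o1 o2.
have := normcD (b1 + b2 + b3) b4; have := normcD (b1 + b2) b3; have := normcD b1 b2.
have : normc (f b) * 4%:R <= normc (f b) * (T1 + T2 + T3 + T4).
  by rewrite ler_wpM2l ?normc_ge0 //; lra.
lra.
Qed.

End CauchyEstimate.

(** * Maximum principle, Schwarz lemma and identity theorem on a disc *)

Section MaximumPrinciple.
Variable R : realType.
Notation C := R[i].
Implicit Types (f g : C -> C) (p V z c : C).
Notation j := ('i%C : C).

Lemma in_square_box b (r : R) z : in_square (b - (1 + j) * r%:C%C) (2%:R * r%:C%C) z ->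
  in_box b r z.
Proof.
move=> [x [y [hx hy ->]]]; exists (2%:R * x - 1), (2%:R * y - 1); split; [lra|lra|].
by rewrite !rmorphB !rmorphM !rmorph1 /= !rmorph_nat; ring.
Qed.

Lemma in_square_quarter p V z : in_square p V z ->
  [\/ in_square p (V / 2%:R) z, in_square (p + V / 2%:R) (V / 2%:R) z,
      in_square (p + j * (V / 2%:R)) (V / 2%:R) z |
      in_square (p + V / 2%:R + j * (V / 2%:R)) (V / 2%:R) z].
Proof.
have tC : (2%:R : C) != 0 by rewrite pnatr_eq0.
move=> [x [y [hx hy ->]]].
have [x1|x1] := lerP x (1 / 2%:R); have [y1|y1] := lerP y (1 / 2%:R).
- apply: Or41; exists (2%:R * x), (2%:R * y); split; [lra|lra|].
  by rewrite !rmorphM /= !rmorph_nat; field.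
- apply: Or43; exists (2%:R * x), (2%:R * y - 1); split; [lra|lra|].
  by rewrite !rmorphB !rmorphM rmorph1 /= !rmorph_nat; field.
- apply: Or42; exists (2%:R * x - 1), (2%:R * y); split; [lra|lra|].
  by rewrite !rmorphB !rmorphM rmorph1 /= !rmorph_nat; field.
- apply: Or44; exists (2%:R * x - 1), (2%:R * y - 1); split; [lra|lra|].
  by rewrite !rmorphB !rmorphM rmorph1 /= !rmorph_nat; field.
Qed.

Lemma bounded_on_box g b (r : R) :
  (forall z, in_box b r z -> cderivable g z) ->
  exists M, forall z, in_box b r z -> normc (g z) <= M.
Proof.
move=> gd.
suff [M HM] : exists M, forall z, in_square (b - (1 + j) * r%:C%C) (2%:R * r%:C%C) z ->
    normc (g z) <= M by exists M => z /in_box_square; apply: HM.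
apply: (@square_bisection _ (fun q W => exists M, forall z, in_square q W z -> normc (g z) <= M)).
  move=> q W [M1 H1] [M2 H2] [M3 H3] [M4 H4].
  exists (Num.max (Num.max M1 M2) (Num.max M3 M4)) => z /in_square_quarter H.
  rewrite !le_max; case: H => [/H1->|/H2->|/H3->|/H4->]; by rewrite ?orbT.
move=> c /in_square_box /gd /cderivable_locally_bounded[M [d d0 Hd]].
exists (d / 2%:R); first by rewrite divr_gt0 ?ltr0n.
move=> q W qWc Wd; exists M => z /in_square_dist/(_ qWc) zc; apply: Hd.
by apply: le_lt_trans zc _; lra.
Qed.

Lemma ge_Bernoulli (s : R) n : 0 <= s -> 1 + n%:R * s <= (1 + s) ^+ n.
Proof.
move=> s0; elim: n => [|n IH]; first by rewrite mul0r addr0 expr0.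
rewrite exprS -natr1.
have : (1 + s) * (1 + n%:R * s) <= (1 + s) * (1 + s) ^+ n by rewrite ler_wpM2l //; lra.
have : 0 <= n%:R * s * s by rewrite !mulr_ge0 ?ler0n.
lra.
Qed.

Lemma le_of_exp_bound (q M K : R) : 0 < M -> 0 <= q ->
  (forall k, q ^+ k.+1 <= K * M ^+ k.+1) -> q <= M.
Proof.
move=> M0 q0 H; rewrite leNgt; apply/negP => Mq.
pose s := q / M - 1.
have s0 : 0 < s by rewrite subr_gt0 ltr_pdivlMr // mul1r.
have H' k : 1 + k.+1%:R * s <= K.
  apply: le_trans (ge_Bernoulli _ (ltW s0)) _.
  rewrite /s addrC subrK expr_div_n ler_pdivrMr ?exprn_gt0 //; exact: H.
have := H' (Num.bound (K / s)); have := archi_boundP.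
move=> /(_ R (K / s)) => A.
have K0 : 0 <= K / s.
  by rewrite divr_ge0 ?(ltW s0) //; have := H' 0%N; lra.
have := A K0; rewrite ltr_pdivrMr // => lt1 le1.
have : (Num.bound (K / s))%:R * s <= (Num.bound (K / s)).+1%:R * s.
  by rewrite ler_pM2r // ler_nat.
lra.
Qed.

(** Landau's power trick: [cauchy_estimate] applied to D^2 (S/D)^k bounds
    (|S b|/|D b|)^k by a constant times M^k, for every k.  The factor D^2
    makes these functions derivable at the zeros of D, with derivative 0, as
    soon as S/D is locally bounded. *)
Lemma quotient_maximum_principle (S D : C -> C) b (r M : R) : 0 < r -> 0 < M ->
  (forall z, in_box b r z -> cderivable S z /\ cderivable D z) ->
  (forall z, in_box b r z -> D z = 0 -> exists A, exists2 d : R, 0 < d &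
     forall w, normc (w - z) < d -> normc (S w) <= A * normc (D w)) ->
  (forall z, in_box b r z -> r <= normc (z - b) -> normc (S z) <= M * normc (D z)) ->
  normc (S b) <= M * normc (D b).
Proof.
move=> r0 M0 SDd SDloc SDM.
have bb : in_box b r b.
  exists 0, 0; split; [lra|lra|]; by rewrite rmorph0 mulr0 addr0 mul0r addr0.
have [Db0|Db0] := eqVneq (D b) 0.
  have [A [d d0 /(_ b)]] := SDloc b bb Db0.
  by rewrite subrr normc0 => /(_ d0); rewrite Db0 normc0 !mulr0.
have Dpos w : D w != 0 -> 0 < normc (D w).
  by rewrite normc_gt0.
have [B HB] := bounded_on_box (fun z bz => (SDd z bz).2).
have B0 : 0 <= B by apply: le_trans (normc_ge0 (D b)) (HB b bb).
rewrite -ler_pdivrMr ?Dpos //.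
apply: (@le_of_exp_bound _ _ (2%:R * B ^+ 2 / normc (D b) ^+ 2)) => //.
  by rewrite divr_ge0 ?normc_ge0.
move=> k.
pose H z := D z ^+ 2 * (S z * (D z)^-1) ^+ k.+1.
have quot w A : 0 <= A -> normc (S w) <= A * normc (D w) ->
    normc (S w * (D w)^-1) <= A.
  move=> A0 hw; have [Dw|Dw] := eqVneq (D w) 0.
    by rewrite Dw invr0 mulr0 normc0.
  by rewrite normcM normcV ler_pdivrMr ?Dpos.
have Hd z : in_box b r z -> cderivable H z.
  move=> bz; have [Sz Dz] := SDd z bz.
  have [Dz0|Dz0] := eqVneq (D z) 0; last first.
    apply: (@cderivableM _ (fun z => D z ^+ 2) (fun z => (S z * (D z)^-1) ^+ k.+1)).
      exact: cderivableX.
    apply: cderivableX; apply: (@cderivableM _ S (fun z => (D z)^-1)) => //.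
    exact: cderivableV.
  have [A [d1 d10 HA]] := SDloc z bz Dz0.
  have [be /(_ 1 ltr01)[d2 d20 HD]] := Dz.
  pose L := normc be + 1.
  have L0 : 0 <= L by rewrite addr_ge0 ?normc_ge0.
  have DL w : normc (w - z) < d2 -> normc (D w) <= L * normc (w - z).
    move=> /HD; rewrite Dz0 subr0 => hw.
    have -> : D w = be * (w - z) + (D w - be * (w - z)) by ring.
    by rewrite (le_trans (normcD _ _)) // normcM mulrDl lerD2l.
  pose K := L ^+ 2 * `|A| ^+ k.+1.
  have K0 : 0 <= K by rewrite mulr_ge0 ?exprn_ge0.
  exists 0 => e e0; exists (Num.min (Num.min d1 d2) (e / (K + 1))).
    by rewrite !lt_min d10 d20 divr_gt0 //; lra.
  move=> w; rewrite !lt_min => /andP[/andP[w1 w2] w3].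
  have -> : H w - H z - 0 * (w - z) = H w by rewrite /H Dz0; ring.
  have n0 := normc_ge0 (w - z).
  apply: (@le_trans _ _ (K * normc (w - z) * normc (w - z))).
    have -> : K * normc (w - z) * normc (w - z) =
        (L * normc (w - z)) ^+ 2 * `|A| ^+ k.+1 by rewrite /K; ring.
    rewrite /H normcM !normcX.
    apply: ler_pM; rewrite ?exprn_ge0 ?normc_ge0 //.
      by rewrite lerXn2r ?nnegrE ?normc_ge0 ?mulr_ge0 ?normc_ge0 // DL.
    rewrite lerXn2r ?nnegrE ?normc_ge0 //; apply: quot => //.
    apply: le_trans (HA _ w1) _; rewrite ler_wpM2r ?normc_ge0 //; exact: ler_norm.
  apply: ler_wpM2r => //.
  have : K * normc (w - z) <= K * (e / (K + 1)) by apply: ler_wpM2l => //; apply: ltW.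
  move/le_trans; apply; rewrite mulrCA ler_piMr ?(ltW e0) // ler_pdivrMr; lra.
have := @cauchy_estimate _ H b r (B ^+ 2 * M ^+ k.+1) r0 Hd.
have {}HM z : in_box b r z -> r <= normc (z - b) -> normc (H z) <= B ^+ 2 * M ^+ k.+1.
  move=> bz zr; rewrite /H normcM !normcX.
  apply: ler_pM; rewrite ?exprn_ge0 ?normc_ge0 //.
    by rewrite lerXn2r ?nnegrE ?normc_ge0 // HB.
  rewrite lerXn2r ?nnegrE ?normc_ge0 ?(ltW M0) //; apply: quot; first exact: (ltW M0).
  exact: SDM.
move=> /(_ HM); rewrite /H normcM !normcX normcM normcV => HH.
rewrite mulrAC ler_pdivlMr ?exprn_gt0 ?Dpos // mulrC.
by rewrite -!mulrA in HH *.
Qed.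

(** The Schwarz lemma for the quotient S/T, from the maximum principle for
    S/(zT) on the box of half side 3 around the point 1: on its boundary
    |z| >= 2.  The discs are normalized so that two given points have
    parameters 0 and 1. *)
Lemma schwarz_lemma (S T : C -> C) :
  (forall z, normc z < 8%:R -> cderivable S z /\ cderivable T z) ->
  (forall z, normc z < 8%:R -> normc (S z) <= normc (T z)) ->
  S 0 = 0 -> T 0 != 0 -> normc (S 1) <= 1 / 2%:R * normc (T 1).
Proof.
move=> STd ST S0 T0.
have r0 : 0 < 3%:R :> R by rewrite ltr0n.
have h0 : 0 < 1 / 2%:R :> R by rewrite divr_gt0 ?ltr0n.
have nz z : normc z <= normc (z - 1) + 1.
  by rewrite -[in leLHS](subrK 1 z) (le_trans (normcD _ _)) // normc1.
have bz8 z : in_box 1 3%:R z -> normc z < 8%:R.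
  move=> bz; apply: le_lt_trans (nz z) _; have := in_box_dist (ltW r0) bz; lra.
have := @quotient_maximum_principle S (fun z => z * T z) 1 3%:R (1 / 2%:R) r0 h0.
rewrite [1 * T 1]mul1r; apply.
- move=> z /bz8 /STd [Sz Tz]; split=> //.
  by apply: (@cderivableM _ (fun z => z)) => //; apply: cderivable_id.
- move=> z bz _; have z8 := bz8 z bz.
  have [->|z0] := eqVneq z 0.
    have [|[be /(_ 1 ltr01)[d1 d10 HS]] [ga HT]] := STd 0; first by rewrite normc0 ltr0n.
    have tpos : 0 < normc (T 0).
      by rewrite normc_gt0.
    have [d2 d20 {}HT] := HT 1 ltr01.
    pose G := normc ga + 1; pose L := normc be + 1.
    have G0 : 0 < G by rewrite /G; have := normc_ge0 ga; lra.
    have L0 : 0 < L by rewrite /L; have := normc_ge0 be; lra.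
    exists (L / (normc (T 0) / 2%:R)).
    exists (Num.min (Num.min d1 d2) (normc (T 0) / 2%:R / G)).
      by rewrite !lt_min d10 d20 !divr_gt0 ?ltr0n.
    move=> w; rewrite !lt_min => /andP[/andP[w1 w2] w3].
    have Sw : normc (S w) <= L * normc w.
      have := HS w w1; rewrite S0 !subr0 => hw.
      have -> : S w = be * w + (S w - be * w) by ring.
      by rewrite (le_trans (normcD _ _)) // normcM mulrDl lerD2l.
    have Tw : normc (T 0) / 2%:R <= normc (T w).
      have := HT w w2; rewrite !subr0 in w3 * => hw.
      have e1 : normc (T w - T 0) <= G * normc w.
        have -> : T w - T 0 = ga * w + (T w - T 0 - ga * w) by ring.
        by rewrite (le_trans (normcD _ _)) // normcM mulrDl lerD2l.
      rewrite ltr_pdivlMr // mulrC in w3.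
      have := normcB (T w) (T w - T 0); rewrite opprB addrC subrK; lra.
    apply: le_trans Sw _; rewrite normcM -!mulrA ler_pM2l //.
    rewrite mulrCA ler_peMr ?normc_ge0 // mulrC ler_pdivlMr ?mul1r //.
    by rewrite divr_gt0 ?ltr0n.
  exists (normc z / 2%:R)^-1.
  have nz0 : 0 < normc z by rewrite normc_gt0.
  exists (Num.min (normc z / 2%:R) (8%:R - normc z)).
    by rewrite lt_min divr_gt0 ?ltr0n // subr_gt0.
  move=> w; rewrite lt_min => /andP[w1 w2].
  have w8 : normc w < 8%:R.
    by rewrite -(subrK z w) (le_lt_trans (normcD _ _)) //; lra.
  apply: le_trans (ST _ w8) _.
  rewrite normcM mulrA ler_peMl ?normc_ge0 // mulrC ler_pdivlMr ?divr_gt0 ?ltr0n //.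
  have : normc z <= normc w + normc (w - z).
    by rewrite (normc_dist w) -{1}(subrK w z) addrC normcD.
  lra.
- move=> z bz z3; apply: le_trans (ST _ (bz8 _ bz)) _.
  rewrite normcM mulrA ler_peMl ?normc_ge0 //.
  have := normcB z 1; rewrite normc1; lra.
Qed.

(** If f vanishes near 0 then f/z^k is locally bounded for every k, so the
    maximum principle on the box of half side 3 around 1, on the boundary of
    which |z| >= 2, gives |f 1| <= B/2^k. *)
Lemma vanishing_along_disc (f : C -> C) :
  (forall z, normc z < 8%:R -> cderivable f z) ->
  (exists2 d : R, 0 < d & forall z, normc z < d -> f z = 0) -> f 1 = 0.
Proof.
move=> fd [d d0 f0].
have r0 : 0 < 3%:R :> R by rewrite ltr0n.
have nz z : normc z <= normc (z - 1) + 1.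
  by rewrite -[in leLHS](subrK 1 z) (le_trans (normcD _ _)) // normc1.
have bz8 z : in_box 1 3%:R z -> normc z < 8%:R.
  move=> bz; apply: le_lt_trans (nz z) _; have := in_box_dist (ltW r0) bz; lra.
have [B HB] := @bounded_on_box f 1 3%:R (fun z bz => fd z (bz8 z bz)).
have B1 : 0 < `|B| + 1 by have := normr_ge0 B; lra.
suff H k : normc (f 1) <= (`|B| + 1) / 2%:R ^+ k.
  apply: eq0_normc; apply/eqP; rewrite eq_le normc_ge0 andbT leNgt; apply/negP => f1.
  by have [k] := half_pow_lt (`|B| + 1) f1; rewrite ltNge H.
have := @quotient_maximum_principle f (fun z => z ^+ k) 1 3%:R ((`|B| + 1) / 2%:R ^+ k) r0.
rewrite expr1n normc1 mulr1; apply.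
- by rewrite divr_gt0 ?exprn_gt0 ?ltr0n.
- move=> z bz; split; first exact/fd/bz8.
  by apply: cderivableX; apply: cderivable_id.
- move=> z bz /eqP; rewrite expf_eq0 => /andP[_ /eqP ->].
  by exists 0; exists d => // w; rewrite subr0 => /f0 ->; rewrite normc0 mul0r.
- move=> z bz z3; rewrite normcX.
  have z2 : 2%:R <= normc z by have := normcB z 1; rewrite normc1; lra.
  apply: (@le_trans _ _ (`|B| + 1)).
    by apply: le_trans (HB _ bz) _; have := ler_norm B; lra.
  rewrite mulrAC ler_pdivlMr ?exprn_gt0 ?ltr0n //; apply: ler_wpM2l; first exact: ltW.
  by rewrite lerXn2r ?nnegrE ?ler0n ?normc_ge0.
Qed.

End MaximumPrinciple.

(** * Analytic discs in the base manifold *)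

Section AnalyticDiscs.
Variable R : realType.
Notation C := R[i].
Variables (n : nat) (X : topologicalType) (A : set (chart R X n)).
Variables (E : X -> lmodType C) (T : set (trivialization E)).
Notation V := (dual_sections A T).

(** All that is used of the charts of X and of the trivializations of L near a
    point: a frame of L over N, and through any two points of N an analytic
    disc along which the sections of L^*, evaluated on the frame, are complex
    derivable.  The discs may leave N. *)
Definition disc_frame (N : set X) (e : forall x, E x) :=
  (forall x (v : E x), N x -> exists k : C, v = k *: e x) /\
  forall a b, N a -> N b -> exists g : C -> X,
    [/\ g 0 = a, g 1 = b,
        (forall f, V f -> forall z, normc z < 8%:R ->
           cderivable (fun z => f (Tagged E (e (g z)))) z) &
        (forall U, nbhs a U -> exists2 d : R, 0 < d &
           forall z, normc z < d -> U (g z))].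

(** The discs are the affine ones in a chart.  Points of N have
    coordinates within r/32 of those of x0, so the disc a + z(b - a) with
    |z| < 8 stays within 17r/32 of them, where the chart and the
    trivialization are defined. *)
Lemma local_disc_frame : complex_manifold A -> holomorphic_line_bundle A T ->
  forall x0 : X, exists2 N, nbhs x0 N & exists e, disc_frame N e.
Proof.
move=> [_ _ Acov Ac _] [Tcov To Tt _] x0.
have [c cA cx0] := Acov x0; have [t tT tx0] := Tcov x0.
have [co io cK cc ic] := Ac c cA.
set D := cdom c in co io cK cc ic *; set I := cmap c @` D in io ic.
have Dc x : D x -> {for x, continuous (cmap c)}.
  by move=> Dx; move: cc; rewrite (continuous_open_subspace _ co) => /(_ x (mem_set Dx)).
have Ic y : I y -> {for y, continuous (cinv c)}.
  by move=> Iy; move: ic; rewrite (continuous_open_subspace _ io) => /(_ y (mem_set Iy)).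
have cK' x : D x -> cinv c (cmap c x) = x by move=> Dx; apply: cK; exact/mem_set.
have Kc y : I y -> cmap c (cinv c y) = y by move=> [x Dx <-]; rewrite cK'.
set y0 := cmap c x0.
have Iy0 : I y0 by exists x0.
have Wn : nbhs x0 (D `&` tdom t).
  by apply: open_nbhs_nbhs; split; [apply: openI => //; exact: To|].
have : nbhs y0 (I `&` (cinv c @^-1` (D `&` tdom t))).
  apply: filterI; first exact: open_nbhs_nbhs.
  by apply: (Ic y0 Iy0); rewrite /y0 cK'.
move=> /nbhs_normP[r /= r0 Hr].
have r320 : 0 < r / 32%:R by rewrite divr_gt0 ?ltr0n.
have By0 : nbhs y0 (ball_ Num.norm y0 (r / 32%:R)).
  exact: (nbhs_ball_norm y0 (PosNum r320)).
exists (D `&` tdom t `&` (cmap c @^-1` ball_ Num.norm y0 (r / 32%:R))).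
  exact: filterI Wn (Dc x0 cx0 _ By0).
exists (fun x => tinv t x 1); split.
  move=> x v [[Dx tx] _]; have [ts tK Kt] := Tt t x tT tx.
  exists (tmap t v); rewrite -[LHS]tK -[RHS]tK; congr (tinv t x _).
  have t0 : tmap t (0 : E x) = 0.
    have := ts 1 0 0; rewrite scale1r addr0 mul1r => E0.
    by apply: (addrI (tmap t (0 : E x))); rewrite -E0 addr0.
  by have := ts (tmap t v) (tinv t x 1) 0; rewrite addr0 t0 addr0 Kt mulr1.
move=> a b [[Da ta] ra] [[Db tb] rb].
pose w := cmap c b - cmap c a.
pose l (z : C) := cmap c a + z *: w.
have lr z : normc z < 8%:R -> ball_ Num.norm y0 r (l z).
  move=> z8; rewrite /ball_ /=.
  have -> : y0 - l z = (y0 - cmap c a) + z *: ((y0 - cmap c b) - (y0 - cmap c a)).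
    rewrite /l /w opprD addrA; congr (_ + _).
    by rewrite -scalerN; congr (_ *: _); rewrite /w !opprB [RHS]addrC addrA subrK.
  apply: le_lt_trans (ler_normD _ _) _; rewrite normrZ.
  have e1 : `|y0 - cmap c b - (y0 - cmap c a)| <= r / 32%:R + r / 32%:R.
    by apply: le_trans (ler_normB _ _) _; apply: lerD; apply: ltW.
  have e2 : `|z| <= 8%:R.
    by rewrite norm_normc -(rmorph_nat (real_complex R)) lecR ltW.
  apply: (@lt_le_trans _ _ (r / 32%:R + 8%:R * (r / 32%:R + r / 32%:R))).
    by apply: ltr_leD => //; apply: ler_pM.
  have -> : r / 32%:R + 8%:R * (r / 32%:R + r / 32%:R) = r * (17%:R / 32%:R).
    by field.
  rewrite ler_piMr ?(ltW r0) // ler_pdivrMr ?ltr0n // mul1r ler_nat //.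
exists (fun z => cinv c (l z)); split.
- by rewrite /l scale0r addr0 cK'.
- by rewrite /l scale1r /w addrC subrK cK'.
- move=> f [fh _] z z8; have [Il [Dl tl]] := Hr _ (lr z z8).
  have [ts tK Kt] := Tt t _ tT tl.
  pose p := row_mx (cmap c a) (const_mx 1 : 'rV[C]_1).
  pose q := row_mx w (0 : 'rV[C]_1).
  have pq x : p + x *: q = row_mx (l x) (const_mx 1).
    by rewrite /p /q scale_row_mx add_row_mx scaler0 addr0.
  have Tc : total_atlas A T (total_chart c t) by exists c => //; exists t.
  have := fh (total_chart c t) (Tagged E (tinv t (cinv c (l z)) 1)) Tc (conj Dl tl) Logic.I.
  have -> : cmap (total_chart c t) (Tagged E (tinv t (cinv c (l z)) 1)) = p + z *: q.
    by rewrite pq /= Kt Kc.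
  move=> /derivable_line /cderivableP.
  set F := (X in cderivable X); set G := (X in _ -> cderivable X z).
  suff -> : F = G by [].
  by apply/funext => x; rewrite /F /G pq /= row_mxKl row_mxKr mxE.
move=> U Ua.
have : nbhs (0 : C) ((fun z => cinv c (l z)) @^-1` U).
  have lc : {for (0 : C), continuous l}.
    exact: (cvgD (cvg_cst (cmap c a)) (@scalel_continuous _ _ w (0 : C))).
  have l0 : l 0 = cmap c a by rewrite /l scale0r addr0.
  have Ua' : nbhs (l 0) (cinv c @^-1` U).
    by rewrite l0; apply: (Ic (cmap c a)); [exists a|rewrite cK'].
  exact: lc Ua'.
move=> /nbhs_norm0P[d /= d0 Hd].
have dE : d = (complex.Re d)%:C%C by rewrite RRe_real // gtr0_real.
exists (complex.Re d); first by rewrite -ltcR -dE.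
by move=> z zd; apply: (Hd z); rewrite /= norm_normc dE ltcR.
Qed.

End AnalyticDiscs.

(** * Identity theorem and Schwarz-Pick inequality for sections *)

Section SchwarzPick.
Variable R : realType.
Notation C := R[i].
Variables (n : nat) (X : topologicalType) (A : set (chart R X n)).
Variables (E : X -> lmodType C) (T : set (trivialization E)).
Notation V := (dual_sections A T).

Lemma sectionZ f (x : X) (k : C) (v : E x) : V f ->
  f (Tagged E (k *: v)) = k * f (Tagged E v).
Proof.
move=> [_ /(_ x) fl].
have f0 : f (Tagged E (0 : E x)) = 0.
  have := fl 1 0 0; rewrite scale1r addr0 mul1r => E0.
  by apply: (addrI (f (Tagged E (0 : E x)))); rewrite -E0 addr0.
by have := fl k v 0; rewrite addr0 f0 addr0.
Qed.

Lemma section_comb f g (a : C) : V f -> V g -> V (fun p => a * f p + g p).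
Proof.
move=> [fh fl] [gh gl]; split.
  move=> c p Ac cp _.
  have := fh c p Ac cp Logic.I; have := gh c p Ac cp Logic.I => dg df.
  have := differentiableD (@differentiableZ _ _ _ _ a _ df) dg.
  by [].
by move=> x k u v /=; rewrite fl gl; ring.
Qed.

Lemma section0 : V (fun=> 0).
Proof.
split; first by move=> c p _ _ _; exact: differentiable_cst.
by move=> x k u v /=; rewrite mulr0 addr0.
Qed.

Hypothesis hX : complex_manifold A.
Hypothesis hL : holomorphic_line_bundle A T.

(** The interior of the zero set is closed: a point of its closure has a
    neighbourhood in which every point is joined by an analytic disc to a point
    near which f vanishes. *)
Lemma identity_theorem f (x0 : X) : V f ->
  nbhs x0 [set x : X | forall v : E x, f (Tagged E v) = 0] -> forall p, f p = 0.
Proof.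
move=> Vf nx0; set Z := [set x : X | _] in nx0.
have Zc : closed Z°.
  move=> x clx; have [N Nx [e [eN dN]]] := local_disc_frame hX hL x.
  have [a [Za Na]] := clx _ Nx.
  apply: filterS Nx => b Nb v.
  have [k ->] := eN b v Nb; rewrite sectionZ //.
  suff -> : f (Tagged E (e b)) = 0 by rewrite mulr0.
  have [g [g0 g1 gd gc]] := dN a b Na Nb.
  rewrite -g1; apply: (@vanishing_along_disc _ (fun z => f (Tagged E (e (g z))))).
    by move=> z; apply: gd.
  have [d d0 Hd] := gc _ Za; exists d => // z /Hd; exact.
have [_ Xconn _ _ _] := hX.
have ZT : Z° = setT.
  apply: Xconn; first by exists x0.
  - by exists Z°; [exact: open_interior|rewrite setTI].
  - by exists Z° => //; rewrite setTI.
move=> [x v]; have : Z° x by rewrite ZT.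
by move/interior_subset; apply.
Qed.

Lemma pick_identity (s t al : C) :
  normc (t - al^*%C * s) ^+ 2 - normc (s - al * t) ^+ 2 =
  (1 - normc al ^+ 2) * (normc t ^+ 2 - normc s ^+ 2).
Proof.
by rewrite !normc_sq; case: s t al => s1 s2 [t1 t2] [a1 a2] /=; ring.
Qed.

(** The Schwarz lemma for S = s - al t and T = t - conj(al) s, where S
    vanishes at a and |S| <= |T| by [pick_identity].  When |al| = 1 the
    function T vanishes at a as well; so s is first multiplied by th < 1, and th
    then tends to 1. *)
Lemma schwarz_pick (N : set X) e s t a b (al : C) : disc_frame A T N e -> V s -> V t ->
  (forall p, normc (s p) <= normc (t p)) -> N a -> N b ->
  t (Tagged E (e a)) != 0 ->
  s (Tagged E (e a)) = al * t (Tagged E (e a)) ->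
  normc (s (Tagged E (e b)) - al * t (Tagged E (e b))) <=
  1 / 2%:R * normc (t (Tagged E (e b)) - (al^*)%C * s (Tagged E (e b))).
Proof.
move=> [eN dN] Vs Vt st Na Nb ta sa.
have [g [g0 g1 gd _]] := dN a b Na Nb.
pose s' z := s (Tagged E (e (g z))); pose t' z := t (Tagged E (e (g z))).
have al1 : normc al <= 1.
  have tp : 0 < normc (t (Tagged E (e a))) by rewrite normc_gt0.
  by have := st (Tagged E (e a)); rewrite sa normcM ger_pMl.
have th (th : R) : 0 < th < 1 ->
  normc (th%:C%C * s' 1 - th%:C%C * al * t' 1) <=
  1 / 2%:R * normc (t' 1 - (th%:C%C * al)^*%C * (th%:C%C * s' 1)).
  move=> /andP[th0 th1]; set be := th%:C%C * al.
  have thn : normc th%:C%C = th by rewrite normc_real gtr0_norm.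
  have be1 : normc be < 1.
    rewrite normcM thn; apply: le_lt_trans th1.
    by rewrite ler_piMr // ltW.
  apply: (@schwarz_lemma _ (fun z => th%:C%C * s' z - be * t' z)
     (fun z => t' z - be^*%C * (th%:C%C * s' z))).
  - move=> z z8; have sd := gd s Vs z z8; have td := gd t Vt z z8.
    have cM (k : C) f : cderivable f z -> cderivable (fun x => k * f x) z.
      move=> fd; apply: (@cderivableM _ (fun=> k) f) => //; exact: cderivable_cst.
    split.
      by apply: (@cderivableB _ (fun z => th%:C%C * s' z) (fun z => be * t' z)); apply: cM.
    apply: (@cderivableB _ t' (fun z => be^*%C * (th%:C%C * s' z))) => //.
    by apply: (cM _ (fun z => th%:C%C * s' z)); apply: cM.
  - move=> z z8; rewrite -(ler_pXn2r (n := 2)) ?nnegrE ?normc_ge0 // -subr_ge0.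
    rewrite pick_identity; apply: mulr_ge0; rewrite subr_ge0.
      by rewrite expr_le1 ?normc_ge0 // ltW.
    rewrite lerXn2r ?nnegrE ?normc_ge0 // normcM thn.
    apply: le_trans (st _); rewrite ler_piMl ?normc_ge0 //; exact: ltW.
  - by rewrite /be /s' /t' g0 sa; ring.
  have -> : t' 0 - be^*%C * (th%:C%C * s' 0) = t' 0 * (1 - normc be ^+ 2)%:C%C.
    have -> : th%:C%C * s' 0 = be * t' 0 by rewrite /be /s' /t' g0 sa; ring.
    have -> : (1 - normc be ^+ 2)%:C%C = 1 - be^*%C * be.
      rewrite rmorphB rmorph1 /=; congr (_ - _); rewrite normc_sq.
      by case: (be) => u w; simpc; congr (_ +i* _)%C; ring.
    ring.
  rewrite mulf_neq0 //; first by rewrite /t' g0.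
  apply/eqP => /complexI E0.
  have : normc be ^+ 2 < 1 by rewrite expr_lt1 ?normc_ge0.
  lra.
rewrite -g1 -/(s' 1) -/(t' 1) leNgt; apply/negP.
set y := 1 / 2%:R * _; set x := normc _ => yx.
pose k := normc (al^*%C * s' 1).
have k0 : 0 <= k := normc_ge0 _.
have x0 : 0 <= x := normc_ge0 _.
(* A value of 1 - th so small that the strict inequality y < x survives. *)
pose de := (x - y) / (2%:R * (x + k + (x - y))).
have xy0 : 0 < x - y by rewrite subr_gt0.
have de0 : 0 < de by rewrite divr_gt0 // mulr_gt0 ?ltr0n //; lra.
have deE : de * (2%:R * (x + k + (x - y))) = x - y.
  by rewrite /de divfK // gt_eqF // mulr_gt0 ?ltr0n //; lra.
have de1 : de < 1 by rewrite /de ltr_pdivrMr; lra.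
clearbody de.
have := th (1 - de); rewrite !gtrBl subr_gt0 de0 de1 => /(_ isT).
have -> : (1 - de)%:C%C * s' 1 - (1 - de)%:C%C * al * t' 1 =
   (1 - de)%:C%C * (s' 1 - al * t' 1) by ring.
rewrite normcM normc_real ger0_norm -/x; last by rewrite subr_ge0 ltW.
have -> : t' 1 - ((1 - de)%:C%C * al)^*%C * ((1 - de)%:C%C * s' 1) =
  (t' 1 - al^*%C * s' 1) + (de * (2%:R - de))%:C%C * (al^*%C * s' 1).
  by case: (t' 1) (s' 1) (al) => t1 t2 [s1 s2] [a1 a2]; simpc; congr (_ +i* _)%C; ring.
move=> H; have := normcD (t' 1 - al^*%C * s' 1) ((de * (2%:R - de))%:C%C * (al^*%C * s' 1)).
rewrite normcM normc_real ger0_norm -/k; last by rewrite mulr_ge0 ?ltW //; lra.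
have d0 := ltW de0.
have h1 : 0 <= de * de * k by rewrite !mulr_ge0.
have h2 : 0 < de * (x - y) by rewrite mulr_gt0.
move=> H2; rewrite -/y in H.
have yE : y = 1 / 2%:R * normc (t' 1 - al^*%C * s' 1) by [].
have : 0 <= de * x by rewrite mulr_ge0.
have : 0 <= de * k by rewrite mulr_ge0.
lra.
Qed.
End SchwarzPick.

(** * Dominated sections are proportional *)

Section Domination.
Variable R : realType.
Notation C := R[i].
Variables (n : nat) (X : topologicalType) (A : set (chart R X n)).
Variables (E : X -> lmodType C) (T : set (trivialization E)).
Notation V := (dual_sections A T).
Hypothesis hX : complex_manifold A.
Hypothesis hXc : compact [set: X].
Hypothesis hL : holomorphic_line_bundle A T.

(** Otherwise each point has a neighbourhood where |s| <= (1 - e) |t| for some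
    e > 0, and by compactness one e serves for all of X. *)
Lemma sup_localizes (s t : {x : X & E x} -> C) :
  (forall e : R, 0 < e -> exists p, t p != 0 /\ (1 - e) * normc (t p) < normc (s p)) ->
  exists x0 : X, forall N, nbhs x0 N -> forall e : R, 0 < e -> exists p,
    [/\ N (tag p), t p != 0 & (1 - e) * normc (t p) < normc (s p)].
Proof.
move=> hsup; apply: contrapT => nx0.
have loc (x : X) : exists N, nbhs x N /\ exists2 e : R, 0 < e & forall p, N (tag p) ->
    normc (s p) <= (1 - e) * normc (t p) \/ t p = 0.
  apply: contrapT => nx; apply: nx0; exists x => N Nx e e0.
  apply: contrapT => np; apply: nx; exists N; split=> //; exists e => // p Np.
  have [tp|tp] := eqVneq (t p) 0; [by right|left].
  by rewrite leNgt; apply/negP => h; apply: np; exists p.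
have := @compact_near_coveringP X setT; move=> [/(_ hXc) + _].
move=> /(_ R (at_right (0 : R)) (fun e x => forall v : E x,
   normc (s (Tagged E v)) <= (1 - e) * normc (t (Tagged E v)) \/ t (Tagged E v) = 0)).
move=> /(_ _)[].
  move=> x _; have [N [Nx [e e0 He]]] := loc x.
  exists (N, [set e' : R | 0 < e' < e]) => /=.
    split=> //; near=> e'; apply/andP; split; near: e'.
      exact: nbhs_right_gt.
    exact: nbhs_right_lt.
  move=> [x' e'] /= [Nx' /andP[e'0 e'e]] v.
  have [h|h] := He (Tagged E v) Nx'; [left|by right].
  apply: le_trans h _; rewrite ler_wpM2r ?normc_ge0 //; lra.
move=> d /= d0 Hd.
have d20 : 0 < d / 2%:R by rewrite divr_gt0 ?ltr0n.
have [p [tp sp]] := hsup _ d20.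
have [|h|h] := Hd (d / 2%:R) _ d20 (tag p) Logic.I (tagged p).
- by rewrite /= sub0r normrN ger0_norm ?ltW //; lra.
- by move: sp; rewrite ltNge; case: p tp h => x v tp /= ->.
- by move: tp; case: p h sp => x v /= -> _; rewrite eqxx.
Unshelve. all: by end_near.
Qed.

(** Near the point given by [sup_localizes], [pick_identity] and
    [schwarz_pick] bound |t|^2 - |s|^2 in terms of 1 - |al|^2, which is
    arbitrarily small; so |s| = |t| there.  The inequality of [schwarz_pick]
    with |al| = 1 then reads |s - al t| <= 1/2 |s - al t|. *)
Lemma domination_normalized s t : V s -> V t ->
  (forall p, normc (s p) <= normc (t p)) ->
  (forall e : R, 0 < e -> exists p, t p != 0 /\ (1 - e) * normc (t p) < normc (s p)) ->
  exists c, forall p, s p = c * t p.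
Proof.
move=> Vs Vt st hsup.
have [x0 Hx0] := sup_localizes hsup.
have [N Nx0 [e dN]] := local_disc_frame hX hL x0.
have [eN _] := dN.
have pk (ep : R) : 0 < ep -> exists a al, [/\ N a, t (Tagged E (e a)) != 0,
    s (Tagged E (e a)) = al * t (Tagged E (e a)), normc al <= 1 & 1 - ep < normc al].
  move=> ep0; have [[a v] [/= Na tp sp]] := Hx0 _ Nx0 _ ep0.
  have [k kE] := eN a v Na; rewrite kE (sectionZ _ _ Vt) in tp.
  rewrite kE (sectionZ _ _ Vt) (sectionZ _ _ Vs) !normcM in sp.
  move: tp; rewrite mulf_eq0 negb_or => /andP[k0 ta].
  have tp : 0 < normc (t (Tagged E (e a))) by rewrite normc_gt0.
  have kp : 0 < normc k by rewrite normc_gt0.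
  exists a, (s (Tagged E (e a)) / t (Tagged E (e a))); split=> //.
  - by rewrite divfK.
  - by rewrite normcM normcV ler_pdivrMr // mul1r.
  - rewrite normcM normcV ltr_pdivlMr //.
    by move: sp; rewrite mulrCA ltr_pM2l.
have same b : N b -> normc (s (Tagged E (e b))) = normc (t (Tagged E (e b))).
  move=> Nb; apply/eqP; rewrite eq_le st /= leNgt; apply/negP.
  set u := s _; set w := t _ => uw.
  have u0 := normc_ge0 u.
  have w0 : 0 < normc w by apply: le_lt_trans uw.
  have uw0 : 0 < normc w - normc u by rewrite subr_gt0.
  (* With 1 - |al|^2 <= 2 ep, [pick_identity] gives
     3/4 (|w| - |u|)^2 <= 2 ep |w|^2 = 1/2 (|w| - |u|)^2. *)
  pose ep := (normc w - normc u) ^+ 2 / (4%:R * normc w ^+ 2).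
  have wp : 0 < normc w ^+ 2 by rewrite exprn_gt0.
  have ep0 : 0 < ep by rewrite divr_gt0 ?exprn_gt0 // mulr_gt0 ?ltr0n.
  have [a [al [Na ta sa al1 alep]]] := pk _ ep0.
  have := schwarz_pick dN Vs Vt st Na Nb ta sa; rewrite -/u -/w.
  have := pick_identity u w al.
  set x := normc (u - _); set y := normc (w - _).
  have y1 : normc w - normc u <= y.
    have : normc w <= normc (w - al^*%C * u) + normc (al^*%C * u).
      by rewrite -[in leLHS](subrK (al^*%C * u) w) normcD.
    rewrite normcM normc_conj -/y.
    have : normc al * normc u <= normc u by rewrite ler_piMl.
    lra.
  move=> pick xy; have xge0 : 0 <= x := normc_ge0 _.
  have y0 : 0 <= y := normc_ge0 _.
  have al0 := normc_ge0 al.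
  have x2 : x ^+ 2 <= 1 / 4%:R * y ^+ 2.
    have -> : 1 / 4%:R * y ^+ 2 = (1 / 2%:R * y) ^+ 2 by field.
    by rewrite lerXn2r ?nnegrE // mulr_ge0 ?divr_ge0 ?ler0n.
  have y2 : (normc w - normc u) ^+ 2 <= y ^+ 2 by rewrite lerXn2r ?nnegrE // ltW.
  have p1 : (1 - normc al ^+ 2) * (normc w ^+ 2 - normc u ^+ 2) <= 2%:R * ep * normc w ^+ 2.
    apply: ler_pM.
    - by rewrite subr_ge0 expr_le1.
    - by rewrite subr_ge0 lerXn2r ?nnegrE // ltW.
    - have -> : 1 - normc al ^+ 2 = (1 - normc al) * (1 + normc al) by ring.
      rewrite mulrC; apply: ler_pM.
      + exact: addr_ge0.
      + by rewrite subr_ge0.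
      + by rewrite -[leRHS]/(1 + 1) lerD2l.
      + by rewrite lerBlDr -lerBlDl ltW.
    - by rewrite lerBlDr lerDl exprn_ge0.
  have epE : ep * normc w ^+ 2 = 1 / 4%:R * (normc w - normc u) ^+ 2.
    by rewrite /ep; field; rewrite gt_eqF.
  have : 0 < (normc w - normc u) ^+ 2 by rewrite exprn_gt0.
  rewrite -mulrA epE in p1; lra.
have [a [al [Na ta sa al1 _]]] := pk _ ltr01.
have al1' : normc al = 1.
  have := same a Na; rewrite sa normcM => h.
  by apply: (mulIf (x := normc (t (Tagged E (e a))))); rewrite ?mul1r // gt_eqF // normc_gt0.
exists al => p; apply/eqP; rewrite -subr_eq0; apply/eqP.
pose f p := - al * t p + s p.
have -> : s p - al * t p = f p by rewrite /f; ring.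
apply: (@identity_theorem _ _ _ _ _ _ hX hL f x0); first exact: section_comb.
apply: filterS Nx0 => b Nb v; have [k ->] := eN b v Nb.
have Vf : V f by exact: section_comb.
rewrite (sectionZ _ _ Vf).
suff -> : f (Tagged E (e b)) = 0 by rewrite mulr0.
have := schwarz_pick dN Vs Vt st Na Nb ta sa.
rewrite /f; set u := s _; set w := t _.
have -> : w - al^*%C * u = - (al^*%C) * (u - al * w).
  have : al^*%C * al = 1.
    have : (normc al ^+ 2)%:C%C = 1 :> C by rewrite al1' expr1n.
    rewrite normc_sq => <-; case: (al) => p1 p2; simpc.
    by congr (_ +i* _)%C; ring.
  by move=> h; ring: h.
rewrite normcM normcN normc_conj al1' mul1r => h.
have -> : - al * w + u = u - al * w by ring.
apply: eq0_normc; apply/eqP; rewrite eq_le normc_ge0 andbT.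
have := normc_ge0 (u - al * w); lra.
Qed.

Lemma domination s t (K : R) : V s -> V t ->
  (forall p, normc (s p) <= K * normc (t p)) -> exists c, forall p, s p = c * t p.
Proof.
move=> Vs Vt st.
pose Q := [set r : R | exists p, t p != 0 /\ r = normc (s p) / normc (t p)].
have Qub : ubound Q K.
  by move=> _ [p [tp ->]]; rewrite ler_pdivrMr ?normc_gt0.
have t0s0 p : t p = 0 -> s p = 0.
  move=> tp; apply: eq0_normc; apply/eqP; rewrite eq_le normc_ge0 andbT.
  by have := st p; rewrite tp normc0 mulr0.
have [p0|np] := pselect (exists p, t p != 0); last first.
  by exists 0 => p; rewrite mul0r; apply: t0s0; apply: contrapT => /eqP h; apply: np; exists p.
have Q0 : Q !=set0 by have [p tp] := p0; exists (normc (s p) / normc (t p)), p.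
pose M := sup Q.
have supQ : has_sup Q by split=> //; exists K.
have sM p : normc (s p) <= M * normc (t p).
  have [tp|tp] := eqVneq (t p) 0; first by rewrite (t0s0 _ tp) tp normc0 mulr0.
  rewrite -ler_pdivrMr ?normc_gt0 //; apply: ub_le_sup; first by exists K.
  by exists p.
have M0 : 0 <= M.
  have [p tp] := p0; have := sM p; have := normc_ge0 (s p).
  by move=> h1 /(le_trans h1); rewrite pmulr_lge0 ?normc_gt0.
have [Mz|Mp] := eqVneq M 0.
  exists 0 => p; rewrite mul0r; apply: eq0_normc; apply/eqP.
  by rewrite eq_le normc_ge0 andbT; have := sM p; rewrite Mz mul0r.
have {M0} Mp : 0 < M by rewrite lt_def Mp.
have MC : (M%:C%C : C) != 0 by apply/eqP => /complexI h; rewrite h ltxx in Mp.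
have nMi : normc ((M%:C%C)^-1 : C) = M^-1 by rewrite normcV normc_real gtr0_norm.
have [|||c Hc] := @domination_normalized (fun p => (M%:C%C)^-1 * s p + 0) t _ Vt.
- exact: (section_comb _ Vs (section0 A T)).
- by move=> p; rewrite addr0 normcM nMi ler_pdivrMl.
- move=> ep ep0; have eM : 0 < ep * M by rewrite mulr_gt0.
  have [_ [p [tp ->]] h] := sup_adherent eM supQ.
  exists p; split=> //; rewrite addr0 normcM nMi ltr_pdivlMl //.
  move: h; rewrite ltr_pdivlMr ?normc_gt0 // -/M; apply: le_lt_trans.
  by rewrite le_eqVlt; apply/orP; left; apply/eqP; ring.
exists (M%:C%C * c) => p; rewrite -mulrA -Hc addr0 mulrA divff // mul1r //.
Qed.
End Domination.

(** * Hermitian forms nonnegative on short sums *)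

Section HermitianForms.
Variable F : numClosedFieldType.
Local Open Scope sesquilinear_scope.

Lemma adjM m n p (A : 'M[F]_(m, n)) (B : 'M[F]_(n, p)) :
  (A *m B)^t* = B^t* *m A^t*.
Proof. by rewrite trmx_mul map_mxM. Qed.

Lemma adjD m n (A B : 'M[F]_(m, n)) : (A + B)^t* = A^t* + B^t*.
Proof. by apply/matrixP => i j; rewrite !mxE rmorphD. Qed.

Lemma adj0 m n : (0 : 'M[F]_(m, n))^t* = 0.
Proof. by apply/matrixP => i j; rewrite !mxE rmorph0. Qed.

Definition qf n (H : 'M[F]_n) (x : 'rV[F]_n) : F := (x *m H *m x^t*) 0 0.

Lemma qf_real n (H : 'M[F]_n) x : H^t* = H -> qf H x \is Num.real.
Proof.
move=> hH; rewrite CrealE; apply/eqP.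
have {2}-> : qf H x = ((x *m H *m x^t*)^t*) 0 0 by rewrite !adjM trmxCK hH mulmxA.
by rewrite /qf !mxE.
Qed.

Lemma qfD n (H : 'M[F]_n) x y : H^t* = H -> x *m H *m y^t* = 0 ->
  qf H (x + y) = qf H x + qf H y.
Proof.
move=> hH xy.
have yx : y *m H *m x^t* = 0.
  have : (y *m H *m x^t*)^t* = 0 by rewrite !adjM trmxCK hH mulmxA.
  by move/(congr1 (fun M => M^t*)); rewrite trmxCK adj0.
by rewrite /qf adjD !mulmxDl !mulmxDr xy yx addr0 add0r mxE.
Qed.

Lemma qf_mul n (H : 'M[F]_n) (l : 'M[F]_1) x :
  qf H (l *m x) = `|l 0 0| ^+ 2 * qf H x.
Proof.
rewrite /qf adjM.
have -> : l *m x *m H *m (x^t* *m l^t*) = l *m (x *m H *m x^t*) *m l^t*.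
  by rewrite !mulmxA.
set M := x *m H *m x^t*.
rewrite mxE big_ord1 mxE big_ord1 [(l^t*) _ _]mxE [(l^T)%R _ _]mxE normCK; ring.
Qed.

Lemma qf1E n (x : 'rV[F]_n) : qf 1%:M x = \sum_i `|x 0 i| ^+ 2.
Proof. by rewrite /qf mulmx1 mxE; apply: eq_bigr => i _; rewrite !mxE normCK. Qed.

Lemma qf1_ge0 n (x : 'rV[F]_n) : 0 <= qf 1%:M x.
Proof. by rewrite qf1E sumr_ge0 // => i _; rewrite exprn_ge0. Qed.

Lemma qf1_eq0 n (x : 'rV[F]_n) : qf 1%:M x = 0 -> x = 0.
Proof.
move/eqP; rewrite qf1E psumr_eq0 => [/allP h|i _]; last by rewrite exprn_ge0.
apply/rowP => i; rewrite mxE; apply/eqP; rewrite -normr_eq0 -[_ == 0]sqrf_eq0.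
by apply: h; rewrite mem_index_enum.
Qed.

Lemma qf_perturb n (H : 'M[F]_n) ep x :
  qf (H + ep *: 1%:M) x = qf H x + ep * qf 1%:M x.
Proof. by rewrite /qf mulmxDr mulmxDl mxE; congr (_ + _); rewrite -scalemxAr -scalemxAl mxE. Qed.

Section Points.
Variables (I : Type) (d : nat) (Y : I -> 'rV[F]_d) (i0 : I).
Hypothesis span : forall f : 'cV[F]_d, (forall i, Y i *m f = 0) -> f = 0.

(** A new point is found with a vector Y i that the cokernel of the previous
    ones does not annihilate. *)
Lemma independent_points m : (m <= d)%N ->
  exists z : nat -> I, row_free (\matrix_(i < m) Y (z i)).
Proof.
elim: m => [|m IH] md.
  by exists (fun=> i0); apply: inj_row_free => v _; apply/rowP => -[].
have [z zf] := IH (ltnW md).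
set W := \matrix_(i < m) _ in zf.
have [i Wi] : exists i, Y i *m cokermx W != 0.
  apply: contrapT => h.
  have Y0 i : Y i *m cokermx W = 0.
    by apply/eqP; apply: contrapT => /negP Yi; apply: h; exists i.
  have c0 : cokermx W = 0.
    apply/matrixP => k j; have := span (f := col j (cokermx W)).
    move=> /(_ _)/(congr1 (fun M : 'cV_d => M k 0)); rewrite !mxE; apply => l.
    by rewrite colE mulmxA Y0 mul0mx.
  have := mxrank_coker W; rewrite c0 mxrank0 (eqP zf) => /esym/eqP.
  by rewrite subn_eq0 leqNgt md.
exists (fun k => if (k < m)%N then z k else i).
apply: inj_row_free => v vM.
have {}vM : (\row_(k < m) v 0 (widen_ord (leqnSn m) k)) *m W + v 0 ord_max *: Y i = 0.
  rewrite -vM [RHS]mulmx_sum_row big_ord_recr /= rowK /= ltnn; congr (_ + _).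
  rewrite mulmx_sum_row; apply: eq_bigr => k _.
  by rewrite !rowK /= ltn_ord mxE.
have vmax : v 0 ord_max = 0.
  have := congr1 (mulmx^~ (cokermx W)) vM.
  rewrite mul0mx mulmxDl -mulmxA mulmx_coker mulmx0 add0r -scalemxAl => /eqP.
  by rewrite scaler_eq0 (negbTE Wi) orbF => /eqP.
move: vM; rewrite vmax scale0r addr0 => vM.
have v' : \row_(k < m) v 0 (widen_ord (leqnSn m) k) = 0.
  by apply: (row_free_inj zf); rewrite vM mul0mx.
apply/rowP => k; rewrite mxE.
have [km|mk] := ltnP k m.
  have := congr1 (fun w : 'rV_m => w 0 (Ordinal km)) v'; rewrite !mxE => <-.
  by congr (v 0 _); apply: val_inj.
rewrite -vmax; congr (v 0 _); apply: val_inj => /=.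
by apply/eqP; rewrite eqn_leq mk -ltnS ltn_ord.
Qed.
End Points.

(** The form is perturbed to be positive definite on the span W of k independent
    vectors of the family.  On the orthogonal plane of W it is diagonal in
    a basis (e, u0) with qf e < 0, and [la], [mu] are the coordinates along e
    and u0.  Subtracting its component along W from Y i leaves a sum of k + 1
    vectors of the family, so |la|^2 (- qf e) <= |mu|^2 qf u0. *)
Lemma dominated_pair (I : Type) k (Y : I -> 'rV[F]_k.+2) (i0 : I) (H : 'M[F]_k.+2) :
  H^t* = H ->
  (forall f : 'cV[F]_k.+2, (forall i, Y i *m f = 0) -> f = 0) ->
  (forall (z : 'I_k.+1 -> I) (a : 'I_k.+1 -> F), 0 <= qf H (\sum_i a i *: Y (z i))) ->
  forall eta, qf H eta < 0 ->
  exists la mu : 'cV[F]_k.+2, exists K : F,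
    [/\ 0 <= K, forall i, `|(Y i *m la) 0 0| <= K * `|(Y i *m mu) 0 0| &
        exists e : 'rV[F]_k.+2, e *m la = 1%:M /\ e *m mu = 0].
Proof.
move=> hH span hP eta Heta.
have [z zf] := independent_points i0 span (leq_trans (leqnSn k) (leqnSn _)).
set W := \matrix_(i < k) _ in zf.
have hPW x b i : 0 <= qf H (x *m W + b *: Y i).
  have := hP (fun l => if (l < k)%N then z l else i)
             (fun l => if insub (val l) is Some l' then x 0 l' else b).
  rewrite big_ord_recr /= ltnn insubF ?ltnn // mulmx_sum_row.
  rewrite (eq_bigr (fun l => x 0 l *: row l W)) // => l _.
  by rewrite rowK ltn_ord (valK l).
(* More than half of the negative value at [eta] remains, while the form
   becomes positive definite on every subspace where it was nonnegative. *)
pose N := qf 1%:M eta.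
have N0 : 0 <= N := qf1_ge0 eta.
pose ep := - qf H eta / (2%:R * (N + 1)).
have N1 : 0 < N + 1 by rewrite ltr_wpDl.
have ep0 : 0 < ep by rewrite divr_gt0 ?oppr_gt0 // mulr_gt0 ?ltr0n.
pose H' := H + ep *: 1%:M.
have H'E x : qf H' x = qf H x + ep * qf 1%:M x by exact: qf_perturb.
have H'ge x : qf H x <= qf H' x by rewrite H'E lerDl mulr_ge0 ?qf1_ge0 // ltW.
have eta' : qf H' eta < 0.
  have -> : qf H' eta = qf H eta * ((N + 2%:R) / (2%:R * (N + 1))).
    rewrite H'E -/N /ep; field; rewrite gt_eqF //= pnatr_eq0 //.
  by rewrite pmulr_llt0 // divr_gt0 ?mulr_gt0 ?ltr0n // ltr_wpDl.
have hH' : H'^t* = H'.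
  rewrite /H' adjD hH; congr (_ + _); apply/matrixP => i j; rewrite !mxE rmorphM /=.
  by rewrite rmorph_nat eq_sym; congr (_ * _); apply/CrealP; rewrite gtr0_real.
clearbody H'.
have H'pos x : qf H' x <= 0 -> 0 <= qf H x -> x = 0.
  move=> x0 hx; apply: qf1_eq0; apply/eqP; rewrite eq_le qf1_ge0 andbT.
  rewrite -(pmulr_rle0 _ ep0); apply: le_trans x0; rewrite H'E lerDr //.
have W0 x : 0 <= qf H (x *m W).
  by have := hPW x 0 i0; rewrite scale0r addr0.
pose G := W *m H' *m W^t*.
have Gu : G \in unitmx.
  rewrite -row_free_unit; apply: inj_row_free => v vG.
  have : v *m W = 0.
    apply: H'pos => //; rewrite /qf adjM !mulmxA -!(mulmxA v) -/G (mulmxA v G) vG.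
    by rewrite mul0mx mxE.
  by move/(congr1 (mulmx^~ (pinvmx W))); rewrite mulmxKp // mul0mx.
pose u := eta *m H' *m W^t* *m invmx G.
pose e := eta - u *m W.
have eW : e *m H' *m W^t* = 0.
  rewrite /e !mulmxBl -!(mulmxA u) -/G /u mulmxKV //.
  by rewrite subrr.
(* [u] are the coordinates of the orthogonal projection of [eta] to W. *)
have etaE : eta = e + u *m W by rewrite /e subrK.
clearbody e u.
have e0 : qf H' e < 0.
  apply: le_lt_trans eta'.
  rewrite etaE.
  rewrite [leRHS]qfD //; last by rewrite adjM mulmxA eW mul0mx.
  by rewrite lerDl (le_trans (W0 u)).
(* Orthogonality to W and e amounts to k + 1 linear equations in k + 2
   unknowns. *)
pose Q := H' *m row_mx (W^t*) (e^t*).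
have [u0 u0n u0Q] : exists2 u0 : 'rV_k.+2, u0 != 0 & u0 *m Q = 0.
  exists (nz_row (kermx Q)).
    rewrite nz_row_eq0 -mxrank_eq0 mxrank_ker subn_eq0 -ltnNge.
    by rewrite (leq_ltn_trans (rank_leq_col _)) // addn1.
  by apply/sub_kermxP; exact: nz_row_sub.
have [u0W u0e] : u0 *m H' *m W^t* = 0 /\ u0 *m H' *m e^t* = 0.
  move: u0Q; rewrite /Q mulmxA mul_mx_row -[0]row_mx0 => /eq_row_mx[].
  by [].
pose M := col_mx W (col_mx e u0).
have Mf : row_free M.
  apply: inj_row_free => v; rewrite -[v]hsubmxK -[rsubmx v]hsubmxK.
  move: (lsubmx v) (lsubmx (rsubmx v)) (rsubmx (rsubmx v)) => x l m.
  rewrite /M !mul_row_col => E0.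
  have x0 : x = 0.
    have := congr1 (fun t => t *m (H' *m W^t*)) E0.
    rewrite mul0mx !mulmxDl -!mulmxA. rewrite (mulmxA u0) u0W (mulmxA e) eW !mulmx0 !addr0.
    rewrite (mulmxA W) -/G => /(congr1 (mulmx^~ (invmx G))).
    by rewrite mulmxK // mul0mx.
  move: E0; rewrite x0 mul0mx add0r => E0.
  have l0 : l = 0.
    have := congr1 (fun t => (t *m (H' *m e^t*)) 0 0) E0.
    rewrite mul0mx !mulmxDl -!mulmxA (mulmxA u0) u0e mulmx0 addr0 (mulmxA e).
    rewrite !mxE big_ord1 -/(qf H' e) => /eqP; rewrite mulf_eq0 (lt_eqF e0) orbF => /eqP l0.
    by rewrite [l]mx11_scalar l0 raddf0.
  move: E0; rewrite l0 mul0mx add0r [m]mx11_scalar mul_scalar_mx => /eqP.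
  rewrite scaler_eq0 (negbTE u0n) orbF => /eqP ->.
  by rewrite raddf0 !row_mx0.
have Mfull : row_full M by rewrite /row_full (eqP Mf) addn1 addn2.
pose la := pinvmx M *m col_mx (0 : 'cV_k) (col_mx 1%:M 0).
pose mu := pinvmx M *m col_mx (0 : 'cV_k) (col_mx 0 1%:M).
(* [ka] bounds |la|^2/|mu|^2, and 1 + ka is a bound for its square root. *)
pose ka := `|qf H' u0| / - qf H' e.
have me : 0 < - qf H' e by rewrite oppr_gt0.
have ka0 : 0 <= ka by rewrite divr_ge0 // ltW.
exists la, mu, (1 + ka); split; first by rewrite addr_ge0.
  move=> i; set y := Y i.
  pose c := y *m pinvmx M.
  have yE : c *m M = y by rewrite mulmxKpV // submx_full.
  pose x := lsubmx c; pose l := lsubmx (rsubmx c); pose m := rsubmx (rsubmx c).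
  have cE : c = row_mx x (row_mx l m) by rewrite /x /l /m !hsubmxK.
  have -> : y *m la = l.
    by rewrite /la mulmxA -/c cE !mul_row_col !mulmx0 mulmx1 add0r addr0.
  have -> : y *m mu = m.
    by rewrite /mu mulmxA -/c cE !mul_row_col !mulmx0 mulmx1 !add0r.
  have q0 : 0 <= qf H' (l *m e + m *m u0).
    have -> : l *m e + m *m u0 = (- x) *m W + 1 *: Y i.
      rewrite scale1r -/y -yE cE /M !mul_row_col mulNmx addrA addNr add0r //.
    exact: le_trans (H'ge _).
  have : `|l 0 0| ^+ 2 <= ((1 + ka) * `|m 0 0|) ^+ 2.
    have lu : l *m e *m H' *m (m *m u0)^t* = 0.
      have ue : e *m H' *m u0^t* = 0.
        by have := congr1 (fun M => M^t*) u0e; rewrite !adjM trmxCK hH' adj0 mulmxA.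
      by rewrite adjM mulmxA -(mulmxA l) -(mulmxA l) ue mulmx0 mul0mx.
    rewrite qfD // !qf_mul in q0.
    have : `|l 0 0| ^+ 2 * - qf H' e <= `|m 0 0| ^+ 2 * `|qf H' u0|.
      apply: (@le_trans _ _ (`|m 0 0| ^+ 2 * qf H' u0)).
        by rewrite mulrN -subr_ge0 opprK addrC.
      by rewrite ler_wpM2l ?exprn_ge0 // real_ler_norm // qf_real.
    rewrite -ler_pdivlMr // -mulrA -/ka => /le_trans; apply.
    rewrite exprMn mulrC ler_wpM2r ?exprn_ge0 //.
    by apply: (@le_trans _ _ (1 + ka)); rewrite ?lerDr // ler_eXnr // lerDl.
  by rewrite ler_sqr // nnegrE ?mulr_ge0 ?addr_ge0.
exists e; split.
  have -> : e = row_mx 0 (row_mx 1%:M 0) *m M.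
    by rewrite /M !mul_row_col !mul0mx mul1mx add0r addr0.
  by rewrite /la mulmxA mulmxKp // !mul_row_col !mul0mx mul1mx add0r addr0.
have -> : e = row_mx 0 (row_mx 1%:M 0) *m M.
  by rewrite /M !mul_row_col !mul0mx mul1mx add0r addr0.
by rewrite /mu mulmxA mulmxKp // !mul_row_col !mul0mx mul1mx !add0r.
Qed.
End HermitianForms.

(** * Globalizable metrics as Hermitian forms *)

Section GramMatrix.
Variable R : realType.
Notation C := R[i].
Local Open Scope sesquilinear_scope.
Variables (M : Type) (V : set (M -> C)) (d : nat) (phi : 'I_d -> M -> C).

Definition ev (z : M) : 'rV[C]_d := \row_i phi i z.

Definition gram (B : (M -> C) -> (M -> C) -> C) : 'M[C]_d :=
  \matrix_(i, j) B (phi i) (phi j).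

Lemma ev_spans : is_basis V phi ->
  forall f : 'cV[C]_d, (forall z, ev z *m f = 0) -> f = 0.
Proof.
move=> [_ ind _] f hf; apply/matrixP => i j; rewrite ord1 [RHS]mxE.
apply: (ind (fun i => f i 0)) => z.
have := congr1 (fun m : 'M[C]_1 => m 0 0) (hf z); rewrite !mxE => E.
by rewrite -[RHS]E; apply: eq_bigr => k _; rewrite mxE mulrC.
Qed.

Lemma gram_hermitian B : is_basis V phi -> hermitian_form V B -> (gram B)^t* = gram B.
Proof.
by move=> [hV _ _] [_ hB]; apply/matrixP => i j; rewrite !mxE -hB.
Qed.

Lemma kernel_sum_qf (B : (M -> C) -> (M -> C) -> C) K N (z : 'I_N -> M) (a : 'I_N -> C) :
  (forall z w, K z w = \sum_(i < d) \sum_(j < d)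
       B (phi i) (phi j) * phi i z * (phi j w)^*) ->
  \sum_(i < N) \sum_(j < N) K (z i) (z j) * a i * (a j)^* =
  qf (gram B) (\sum_i a i *: ev (z i)).
Proof.
move=> KE.
have KE' u v : K u v = (ev u *m gram B *m (ev v)^t*) 0 0.
  rewrite KE exchange_big mxE; apply: eq_bigr => j _.
  rewrite !mxE mulr_suml; apply: eq_bigr => i _.
  by rewrite !mxE [phi i u * _]mulrC.
rewrite /qf.
have -> : (\sum_i a i *: ev (z i))^t* = \sum_i (a i)^* *: (ev (z i))^t*.
  apply/matrixP => i j; rewrite !mxE !summxE rmorph_sum; apply: eq_bigr => k _.
  by rewrite !mxE rmorphM.
rewrite mulmx_suml mulmx_suml summxE; apply: eq_bigr => i _.
rewrite mulmx_sumr summxE; apply: eq_bigr => j _.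
rewrite -!scalemxAl -scalemxAr KE' !mxE; ring.
Qed.

Lemma pos_of_dim B : is_basis V phi ->
  (forall (z : 'I_d -> M) (a : 'I_d -> C), 0 <= qf (gram B) (\sum_i a i *: ev (z i))) ->
  forall xi, 0 <= qf (gram B) xi.
Proof.
move=> hphi hP xi.
have [i0|noM] := pselect (exists i0 : M, True); last first.
  have -> : xi = 0.
    have xi0 : xi^T = 0 by apply: (ev_spans hphi) => z; exfalso; apply: noM; exists z.
    by rewrite -[xi]trmxK xi0 trmx0.
  by rewrite /qf mul0mx mul0mx mxE.
have [{}i0 _] := i0.
have [z zf] := independent_points i0 (ev_spans hphi) (leqnn d).
have := hP (fun i => z i) (fun i => (xi *m pinvmx (\matrix_(i < d) ev (z i))) 0 i).
set W := \matrix_(i < d) _ in zf *; set x := xi *m _.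
have -> : \sum_i x 0 i *: ev (z i) = x *m W.
  by rewrite mulmx_sum_row; apply: eq_bigr => i _; rewrite rowK.
by rewrite /x mulmxKpV // submx_full // /row_full (eqP zf).
Qed.

End GramMatrix.

Section Stability.
Variable R : realType.
Notation C := R[i].
Variables (n : nat) (X : topologicalType) (A : set (chart R X n)).
Variables (E : X -> lmodType C) (T : set (trivialization E)).
Notation V := (dual_sections A T).
Hypothesis hX : complex_manifold A.
Hypothesis hXc : compact [set: X].
Hypothesis hL : holomorphic_line_bundle A T.

(** A negative value would give two sections with independent coordinates
    [la] and [mu], one dominated by the other, hence proportional by
    [domination]; since the evaluation vectors span, the coordinates would be
    proportional. *)
Lemma pos_of_dim_pred k (phi : 'I_k.+2 -> {x : X & E x} -> C) B :
  is_basis V phi -> hermitian_form V B ->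
  (forall (z : 'I_k.+1 -> {x : X & E x}) (a : 'I_k.+1 -> C),
     0 <= qf (gram phi B) (\sum_i a i *: ev phi (z i))) ->
  forall xi, 0 <= qf (gram phi B) xi.
Proof.
move=> hphi hB hP xi.
have hH := gram_hermitian hphi hB.
rewrite real_leNgt ?real0 ?qf_real //; apply/negP => xi0.
have [i0|noM] := pselect (exists i0 : {x : X & E x}, True); last first.
  have x0 : xi = 0.
    have xi0' : xi^T = 0 by apply: (ev_spans hphi) => z; exfalso; apply: noM; exists z.
    by rewrite -[xi]trmxK xi0' trmx0.
  by move: xi0; rewrite x0 /qf mul0mx mul0mx mxE ltxx.
have [{}i0 _] := i0.
have [la [mu [K [K0 dom [e [ela emu]]]]]] :=
  dominated_pair i0 hH (ev_spans hphi) hP xi0.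
have [hV _ _] := hphi.
pose sec (f : 'cV[C]_k.+2) z := (ev phi z *m f) 0 0.
have Vsec f : V (sec f).
  suff Vs m : V (fun z => \sum_(i < k.+2 | (i < m)%N) f i 0 * phi i z).
    have -> : sec f = (fun z => \sum_(i < k.+2 | (i < k.+2)%N) f i 0 * phi i z).
      apply/funext => z; rewrite /sec mxE; apply: eq_big => i; rewrite ?ltn_ord //.
      by rewrite mxE mulrC.
    exact: Vs.
  elim: m => [|m IH].
    have -> : (fun z => \sum_(i < k.+2 | (i < 0)%N) f i 0 * phi i z) = fun=> 0.
      by apply/funext => z; rewrite big_pred0.
    exact: section0.
  have [mk|km] := ltnP m k.+2; last first.
    suff -> : (fun z => \sum_(i < k.+2 | (i < m.+1)%N) f i 0 * phi i z) =
      (fun z => \sum_(i < k.+2 | (i < m)%N) f i 0 * phi i z) by [].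
    apply/funext => z; apply: eq_bigl => i.
    by rewrite (leq_trans (ltn_ord i) km) (leq_trans (ltn_ord i) (leqW km)).
  have := section_comb (f (Ordinal mk) 0) (hV (Ordinal mk)) IH.
  congr (dual_sections A T _); apply/funext => z.
  rewrite [RHS](bigD1 (Ordinal mk)) //=; congr (_ + _); apply: eq_bigl => i.
  have [->|ne] := eqVneq i (Ordinal mk); first by rewrite /= ltnn andbF.
  rewrite andbT ltnS [RHS]leq_eqVlt; suff /negbTE -> : (i : nat) != m by [].
  by apply: contra ne => /eqP im; apply/eqP/val_inj.
have [c Hc] : exists c, forall p, sec la p = c * sec mu p.
  apply: (@domination R n X A E T hX hXc hL _ _ (complex.Re K)) => // p.
  have := dom p; rewrite !norm_normc -lecR rmorphM /= RRe_real //.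
  exact: ger0_real.
have lamu : la - c *: mu = 0.
  apply: (ev_spans hphi) => z; apply/matrixP => i j; rewrite !ord1.
  rewrite mulmxBr -scalemxAr [RHS]mxE [LHS]mxE [X in _ + X]mxE [X in - X]mxE.
  by rewrite -/(sec la z) -/(sec mu z) Hc subrr.
have := congr1 (fun m : 'cV[C]_k.+2 => (e *m m) 0 0) lamu.
rewrite mulmxBr -scalemxAr ela emu scaler0 subr0 mulmx0 !mxE => /eqP.
by rewrite oner_eq0.
Qed.
End Stability.

Theorem theorem2 (R : realType) (n : nat) (X : topologicalType)
    (A : set (chart R X n)) (hX : complex_manifold A)
    (hXc : compact [set: X])
    (E : X -> lmodType R[i]) (T : set (trivialization E))
    (hL : holomorphic_line_bundle A T)
    (d : nat) (phi : 'I_d -> {x : X & E x} -> R[i])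
    (hphi : is_basis (dual_sections A T) phi)
    (S : set ({x : X & E x} -> {x : X & E x} -> R[i]))
    (hS : S = globalizable_metrics (dual_sections A T) phi) :
  stable (total_atlas A T) S /\
  ((1 < d)%N -> (stability_index (total_atlas A T) S <= (d%:R)%:E - 1)%E).
Proof.
have inf_le k : S `&` pos_class_infty (total_atlas A T) = S `&` pos_class (total_atlas A T) k ->
    (stability_index (total_atlas A T) S <= (k%:R)%:E)%E.
  by move=> hk; apply: ereal_inf_lbound; exists k.
have eqk k : (forall B, hermitian_form (dual_sections A T) B ->
      (forall (z : 'I_k -> {x : X & E x}) (a : 'I_k -> R[i]),
         0 <= qf (gram phi B) (\sum_i a i *: ev phi (z i))) ->
      forall xi, 0 <= qf (gram phi B) xi) ->
    S `&` pos_class_infty (total_atlas A T) = S `&` pos_class (total_atlas A T) k.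
  move=> hk; apply/seteqP; split => K [SK PK]; split => //.
    case: k {hk} => [|k]; last exact: PK.
    have [hs _] := PK 1%N isT; split=> // z a.
    by rewrite big_ord0.
  move=> N _; have [hs pos] := PK; split => // z a.
  have [B hB KE] : globalizable_metrics (dual_sections A T) phi K by rewrite -hS.
  rewrite (kernel_sum_qf _ _ KE); apply: hk => // z' a'.
  by rewrite -(kernel_sum_qf _ _ KE).
split.
  have h : (stability_index (total_atlas A T) S <= (d%:R)%:E)%E.
    by apply/inf_le/eqk => B _; exact: (pos_of_dim hphi).
  have h0 : (0 <= stability_index (total_atlas A T) S)%E.
    by apply/ereal_infP => _ [k _ <-]; rewrite lee_fin.
  by rewrite /stable ge0_fin_numE // (le_lt_trans h) // ltry.
case: d phi hphi hS inf_le eqk => [//|[//|k]] phi hphi hS inf_le eqk _.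
have -> : ((k.+2%:R)%:E - 1 = (k.+1%:R)%:E :> \bar R)%E.
  by rewrite -EFinB -natr1 addrK.
apply/inf_le/eqk => B hB; exact: (pos_of_dim_pred hX hXc hL hphi hB).
Qed.
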